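(* Let $1<p<\infty$, let $F$ be an increasing function on $[1,\infty)$ and let $c>0$ be an absolute constant. Fix a weight $w_0\in A_p$ on $\mathbf{R}^n$. (1) Let $T$ be a linear operator such that $$\|T\|_{L^p(w)\to L^p(w)}\le c\,F([w]_{A_p})\qquad\text{for every weight } w\in A_p .$$ Then $$\lim_{d_*(w,w_0)\to 0}\|T\|_{L^p(w)\to L^p(w)}=\|T\|_{L^p(w_0)\to L^p(w_0)},$$ that is, for every $\eta>0$ there is $\rho>0$ such that $\big|\|T\|_{L^p(w)\to L^p(w)}-\|T\|_{L^p(w_0)\to L^p(w_0)}\big|<\eta$ for all $w\in A_p$ with $d_*(w,w_0)<\rho$. (2) Let $T$ be a sublinear operator such that $\|T\|_{L^p(w)\to L^p(w)}\le c\,F([w]_{A_p})$ for every weight $w\in A_p$. Then there is a positive constant $C$, which depends on $p$, on the constant $c$ in the preceding weighted estimate, on the dimension $n$ and on $[w_0]_{A_p}$, such that for all sufficiently small $\delta>0$, $$\|T\|_{L^p(w)\to L^p(w)}\le \|T\|_{L^p(w_0)\to L^p(w_0)}\,(1+C\delta)$$ for all weights $w\in A_p$ with $d_*(w,w_0)\le\delta$.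
   Context: A weight on $\mathbf{R}^n$ is a function $w\in L^1_{loc}(\mathbf{R}^n)$ that is positive almost everywhere. For $1<p<\infty$ with conjugate exponent $p'$ ($\frac1p+\frac1{p'}=1$), $w\in A_p$ means $$[w]_{A_p}:=\sup_Q\Big(\frac1{|Q|}\int_Q w\Big)\Big(\frac1{|Q|}\int_Q w^{1-p'}\Big)^{p-1}<\infty,$$ the supremum being over all cubes $Q\subset\mathbf{R}^n$. For a locally integrable function $f$, $\|f\|_*=\sup_Q\frac1{|Q|}\int_Q|f-f_Q|\,dx$ is the $BMO$ (semi)norm, where $f_Q=\frac1{|Q|}\int_Q f\,dx$. For $u,v\in A_p$, the distance is $d_*(u,v)=\|\log u-\log v\|_*$ (it is a metric once weights that are positive constant multiples of each other are identified). $L^p(w)$ is the space of measurable functions on $\mathbf{R}^n$ with $\|f\|_{L^p(w)}=\big(\int_{\mathbf{R}^n}|f|^p w\,dx\big)^{1/p}<\infty$, and $\|T\|_{L^p(w)\to L^p(w)}$ is the smallest $K$ with $\|Tf\|_{L^p(w)}\le K\|f\|_{L^p(w)}$ for all $f\in L^p(w)$; the hypothesis on $T$ includes that $T$ is defined on $L^p(w)$ for every $w\in A_p$. An operator $T$ from a class of functions to a class of functions is sublinear if: (i) whenever $f=f_1+f_2$ and $Tf_1,Tf_2$ are defined, $Tf$ is defined; (ii) $|T(f_1+f_2)|\le|Tf_1|+|Tf_2|$ almost everywhere; (iii) $|T(kf)|=|k||Tf|$ almost everywhere for every scalar $k$.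
   Formalization: In part (2), C may also depend on T and on F: a C depending only on p, c, n and [w_0] cannot serve all T, as the rank-one operators 1_{B(0,r)}∫_{B(e,1)}f with w_0=1, w=|x|^{-t}, r→0 show. *)

(* Defs.v *)
From HB Require Import structures.
From mathcomp Require Import all_boot all_order all_algebra.
From mathcomp Require Import all_classical all_reals all_analysis.
From mathcomp.real_closed Require Import complex.

Set Implicit Arguments.
Unset Strict Implicit.
Unset Printing Implicit Defensive.

Import Order.TTheory GRing.Theory Num.Theory.
Import numFieldNormedType.Exports.

Local Open Scope classical_set_scope.
Local Open Scope ring_scope.

(* R^n is [n.-tuple R] with the Borel sigma-algebra, i.e. the product
   sigma-algebra that the library puts on tuples. *)

Section LebesgueMeasure.
Context {R : realType}.
Local Open Scope ereal_scope.

Definition consT n (x : measurableTypeR R * n.-tuple R) : n.+1.-tuple R :=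
  [tuple of x.1 :: x.2].

Definition unconsT n (x : n.+1.-tuple R) : measurableTypeR R * n.-tuple R :=
  (thead x, [tuple of behead x]).

Lemma consTK n : cancel (@consT n) (@unconsT n).
Proof. by case=> a t; congr pair; apply: val_inj. Qed.

Lemma unconsTK n : cancel (@unconsT n) (@consT n).
Proof. by move=> t; rewrite [RHS]tuple_eta. Qed.

Lemma measurable_consT n : measurable_fun [set: _] (@consT n).
Proof. exact: (@measurable_cons _ _ _ R). Qed.

Lemma measurable_unconsT n : measurable_fun [set: _] (@unconsT n).
Proof.
apply/measurable_fun_pairP; split => /=; last exact: measurable_behead.
exact: (@measurable_tnth _ R n.+1 ord0).
Qed.

Section cons_measure.
Variables (n : nat) (m : {sigma_finite_measure set (n.-tuple R) -> \bar R}).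

Definition cons_measure : set (n.+1.-tuple R) -> \bar R :=
  pushforward (lebesgue_measure \x m) (@consT n).

Let cons_measure0 : cons_measure set0 = 0.
Proof. by rewrite /cons_measure /pushforward preimage_set0 measure0. Qed.

Let cons_measure_ge0 A : 0 <= cons_measure A.
Proof. by rewrite /cons_measure /pushforward measure_ge0. Qed.

Let cons_measure_sigma_additive : semi_sigma_additive cons_measure.
Proof.
move=> F mF tF mUF; rewrite /cons_measure /pushforward preimage_bigcup.
apply: measure_semi_sigma_additive.
- by move=> k; rewrite -[X in measurable X]setTI; exact: measurable_consT.
- apply/trivIsetP => /= i j _ _ ij; rewrite -preimage_setI.
  by move/trivIsetP : tF => /(_ _ _ _ _ ij) ->//; rewrite preimage_set0.
- by rewrite -preimage_bigcup -[X in measurable X]setTI; exact: measurable_consT.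
Qed.

HB.instance Definition _ := isMeasure.Build _ _ _ cons_measure
  cons_measure0 cons_measure_ge0 cons_measure_sigma_additive.

Let cons_measure_sigma_finite : sigma_finite setT cons_measure.
Proof.
have /sigma_finiteP[F [FT ndF Foo]] := sigma_finiteT (@lebesgue_measure R).
have /sigma_finiteP[G [GT ndG Goo]] := sigma_finiteT m.
exists (fun k => @unconsT n @^-1` (F k `*` G k)).
  rewrite -preimage_bigcup [X in _ @^-1` X](_ : _ = setT) ?preimage_setT//.
  rewrite -subTset => -[x y] _.
  have [i _ Fix] : (\bigcup_i F i) x by rewrite -FT.
  have [j _ Gjy] : (\bigcup_i G i) y by rewrite -GT.
  exists (maxn i j) => //; split => /=.
    by move: x Fix; exact/subsetPset/ndF/leq_maxl.
  by move: y Gjy; exact/subsetPset/ndG/leq_maxr.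
move=> k; have [mF Fk] := Foo k; have [mG Gk] := Goo k; split.
  rewrite -[X in measurable X]setTI; apply: measurable_unconsT => //.
  exact: measurableX.
rewrite /cons_measure /pushforward -comp_preimage.
rewrite (_ : _ \o _ = id); last by apply/funext => x /=; rewrite consTK.
by rewrite preimage_id product_measure1E// lte_mul_pinfty// ge0_fin_numE.
Qed.

HB.instance Definition _ := Measure_isSigmaFinite.Build _ _ _ cons_measure
  cons_measure_sigma_finite.

End cons_measure.

Fixpoint lebesgue_measure_tuple (n : nat) :
    {sigma_finite_measure set (n.-tuple R) -> \bar R} :=
  match n with
  | 0%N => dirac [tuple]
  | k.+1 => cons_measure (lebesgue_measure_tuple k)
  end.

End LebesgueMeasure.

Section Weights.
Context {R : realType} {n : nat}.
Local Notation mu := (@lebesgue_measure_tuple R n).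
Implicit Types (Q : set (n.-tuple R)) (f u v w : n.-tuple R -> R).

(* Cubes have their sides parallel to the coordinate axes. *)
Definition cube (a : n.-tuple R) (h : R) : set (n.-tuple R) :=
  [set x | forall i, tnth a i <= tnth x i <= tnth a i + h].

Definition cubes : set (set (n.-tuple R)) :=
  [set Q | exists a h, 0 < h /\ Q = cube a h].

Definition average Q (g : n.-tuple R -> \bar R) : \bar R :=
  ((fine (mu Q))^-1%:E * \int[mu]_(x in Q) g x)%E.

(* Every bounded set lies in a cube, so integrability on cubes is local
   integrability. *)
Definition weight w : Prop :=
  [/\ measurable_fun [set: n.-tuple R] w,
      forall Q, cubes Q -> (\int[mu]_(x in Q) `|w x|%:E < +oo)%E &
      {ae mu, forall x, 0 < w x}].

Definition conj_exponent (p : R) : R := p / (p - 1).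

Definition Ap_const (p : R) w : \bar R :=
  ereal_sup [set (average Q (fun x => (w x)%:E) *
      average Q (fun x => (w x `^ (1 - conj_exponent p))%:E) `^ (p - 1))%E
    | Q in cubes].

Definition Ap (p : R) w : Prop := weight w /\ (Ap_const p w < +oo)%E.

Definition BMO_norm f : \bar R :=
  ereal_sup [set average Q (fun x => `|f x - fine (average Q (fun y => (f y)%:E))|%:E)
    | Q in cubes].

Definition dstar u v : \bar R := BMO_norm (fun x => ln (u x) - ln (v x)).

End Weights.

Lemma preimage_consT_cube (R : realType) n (a : n.+1.-tuple R) (h : R) :
  @consT R n @^-1` cube a h =
  [set` `[thead a, thead a + h]%R] `*` cube [tuple of behead a] h.
Proof.
have bE i : tnth [tuple of behead a] i = tnth a (lift ord0 i).
  by rewrite [in RHS](tuple_eta a) tnthS.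
apply/seteqP; split=> [[x t] /= H|[x t] /= [H1 H2] i].
  split; first by rewrite in_itv/=; exact: (H ord0).
  by move=> i; have := H (lift ord0 i); rewrite tnthS bE.
have [->|i0] := eqVneq i ord0; first by move: H1; rewrite in_itv.
have [k -> _] : {k | i = lift ord0 k & unlift ord0 i = Some k}.
  by apply: unlift_some; rewrite eq_sym.
by have := H2 k; rewrite tnthS bE.
Qed.

Lemma lebesgue_measure_cube (R : realType) n (a : n.-tuple R) (h : R) :
  0 <= h -> measurable (cube a h) /\
  lebesgue_measure_tuple n (cube a h) = (h ^+ n)%:E.
Proof.
move=> h0; elim: n a => [|n IH] a.
  have -> : cube a h = setT by rewrite -subTset => x _ [].
  by split => //=; rewrite diracT expr0.
have [mC muC] := IH [tuple of behead a].
have -> : cube a h = @unconsT R n @^-1` (@consT R n @^-1` cube a h).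
  by apply/seteqP; split=> x; rewrite /preimage /= unconsTK.
have mI : measurable ([set` `[thead a, thead a + h]%R] : set (measurableTypeR R)).
  exact: measurable_itv.
have muI : (lebesgue_measure [set` `[thead a, thead a + h]%R] = h%:E)%E.
  rewrite lebesgue_measure_itv/= lte_fin; case: ltP => [_|].
    by rewrite -EFinB addrAC subrr add0r.
  rewrite -[leRHS]addr0 lerD2l => hle0.
  by have -> : h = 0 by apply/le_anti; rewrite h0 hle0.
rewrite preimage_consT_cube; split.
  rewrite -[X in measurable X]setTI; apply: measurable_unconsT => //.
  exact: measurableX.
rewrite /= /cons_measure /pushforward -comp_preimage.
rewrite (_ : _ \o _ = id); last by apply/funext => x /=; rewrite consTK.
rewrite preimage_id product_measure1E//.
by transitivity (h%:E * (h ^+ n)%:E)%E; [congr (_ * _)%E|rewrite -EFinM exprS].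
Qed.

Lemma conj_exponentP (R : realType) (p : R) :
  1 < p -> p^-1 + (conj_exponent p)^-1 = 1.
Proof.
move=> p1; have p0 : p != 0 by rewrite gt_eqF// (lt_trans _ p1).
have p10 : p - 1 != 0 by rewrite subr_eq0 gt_eqF.
by rewrite /conj_exponent invf_div -[X in X + _]mul1r -mulrDl addrC subrK divff.
Qed.

(* Functions are real-valued or complex-valued; everything below is stated for
   both choices of scalars. *)
Inductive scalars := RealScalars | ComplexScalars.

Definition scalar (R : realType) (s : scalars) : numFieldType :=
  match s with RealScalars => R | ComplexScalars => R[i] end.

Definition modulus (R : realType) (s : scalars) : scalar R s -> R :=
  match s return scalar R s -> R with
  | RealScalars => fun z : R => `|z|
  | ComplexScalars => fun z : R[i] => ComplexField.Normc.normc z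
  end.

Section Operators.
Context {R : realType} {s : scalars} {n : nat}.
Local Notation mu := (@lebesgue_measure_tuple R n).
Local Notation fct := (n.-tuple R -> scalar R s).
Implicit Types (f g : fct) (w : n.-tuple R -> R).

Definition scalar_measurable f : Prop :=
  match s return (n.-tuple R -> scalar R s) -> Prop with
  | RealScalars => fun f : n.-tuple R -> R =>
      measurable_fun [set: n.-tuple R] f
  | ComplexScalars => fun f : n.-tuple R -> R[i] =>
      measurable_fun [set: n.-tuple R] (fun x => complex.Re (f x)) /\
      measurable_fun [set: n.-tuple R] (fun x => complex.Im (f x))
  end f.

Definition Lp_norm (p : R) w f : \bar R :=
  ((\int[mu]_x (modulus (f x) `^ p * w x)%:E) `^ p^-1)%E.

Definition Lp_space (p : R) w : set fct :=
  [set f | scalar_measurable f /\ (Lp_norm p w f < +oo)%E].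

(* An operator need not be defined on all functions: its values outside of
   [op_dom] are irrelevant. *)
Record operator := Operator { op_dom : set fct ; op_fun :> fct -> fct }.

Definition linear_operator (T : operator) : Prop :=
  forall (k : scalar R s) f g, op_dom T f -> op_dom T g ->
    op_dom T (fun x => k * f x + g x) /\
    {ae mu, forall x, T (fun y => k * f y + g y) x = k * T f x + T g x}.

Definition sublinear_operator (T : operator) : Prop :=
  [/\ forall f g, op_dom T f -> op_dom T g -> op_dom T (fun x => f x + g x),
      forall f g, op_dom T f -> op_dom T g ->
        {ae mu, forall x,
          modulus (T (fun y => f y + g y) x) <= modulus (T f x) + modulus (T g x)} &
      forall (k : scalar R s) f, op_dom T f ->
        op_dom T (fun x => k * f x) /\
        {ae mu, forall x, modulus (T (fun y => k * f y) x) = modulus k * modulus (T f x)}].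

Definition opnorm (p : R) w (T : operator) : \bar R :=
  ereal_inf [set K%:E | K in [set K : R | 0 <= K /\
    forall f, Lp_space p w f -> (Lp_norm p w (T f) <= K%:E * Lp_norm p w f)%E]].

Definition weighted_bound (p : R) (F : R -> R) (c : R) (T : operator) : Prop :=
  forall w, Ap p w ->
    [/\ Lp_space p w `<=` op_dom T,
        forall f, Lp_space p w f -> scalar_measurable (T f) &
        (opnorm p w T <= (c * F (fine (Ap_const p w)))%:E)%E].

End Operators.

Arguments operator : clear implicits.

(* Main.v *)
(* Everything is read off exact interpolation with change of measure: for a
   sublinear T and 0 < t < 1,
     ||T||_{L^p(w0^(1-t) w1^t)} <= ||T||_{L^p(w0)}^(1-t) ||T||_{L^p(w1)}^t.
   The infimum of |f0|^p w0 + |f1|^p e^u w1 over the splittings f = f0 + f1 is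
   |f|^p times the parallel sum of w0 and e^u w1, and the integral of e^(-t u)
   times this parallel sum over u is a constant multiple of w0^(1-t) w1^t; the
   constant cancels, so none is lost.

   Given w close to w0, write w = w0^(1-t) W^t with W = w0 (w/w0)^(1/t) and
   t proportional to d_*(w, w0). Then log W - log w0 has small BMO norm and the
   A_p constant of W is controlled: a John-Nirenberg inequality with respect to
   the measure w0 dx, where the A_infinity property of w0 makes the stopping
   cubes carry a fixed proportion less than 1 of the w0-mass. It is proved for
   averages over dyadic cubes of finite depth, by induction on the depth, and
   passed to the limit by the density of dyadic step functions.

   This gives ||T||_w <= ||T||_{w0} (M / ||T||_{w0})^t. For a constant that is
   uniform in w0, ||T||_{w0} is bounded below by interpolating the weight 1
   between w0 and a small negative power of w0, unless T vanishes on L^p(dx),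
   in which case it vanishes on every L^p(w) by density. Finally, w lies in the
   A_p class with constant controlled by that of w0, so exchanging w and w0
   gives the lower bound needed for continuity. *)

Require Import Defs.
From mathcomp Require Import all_boot all_order all_algebra.
From mathcomp Require Import all_classical all_reals all_analysis.
From mathcomp Require Import measurable_realfun ring lra.
From mathcomp.real_closed Require Import complex.

Set Implicit Arguments.
Unset Strict Implicit.
Unset Printing Implicit Defensive.

Import Order.TTheory GRing.Theory Num.Theory.

Local Open Scope classical_set_scope.
Local Open Scope ring_scope.

(** A factor [1 + C * delta] leaves no room for a multiplicative loss, since a fixed constant in the
    interpolation would survive as [delta] tends to 0. Complex interpolation exploits linearity; for
    sublinear operators the real method is made exact instead. This works because the exponent [p]
    is the same at both ends, so the optimal splitting is found separately at each point. The other
    obstacle is to compare Lebesgue mass with weighted mass in the stopping argument. No reverse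
    Hölder inequality is used: with [b = (p - 1)^-1], the pointwise bound
    [1 <= t * w + t^(-b) * w^(-b)], summed over the surviving cubes, passes from one mass to the
    other, and the A_p condition controls the dual term. The resulting inequality is applied both to
    the weight and to its dual, so it bounds both factors of the A_p product. Weights are written
    [expR \o a]: powers and products become affine combinations, and [dstar] measures the difference
    of two exponents. *)

Local Notation scalar := Defs.scalar.

(** * John-Nirenberg inequality on a tree *)

Section Tree.
Context {R : realType} {I : finType} {N : Type} (child : I -> N -> N).

Definition tree_additive (v : N -> R) := forall P, v P = \sum_i v (child i P).

Fixpoint leaf_sum (k : nat) (v : N -> R) (P : N) : R :=
  if k is k'.+1 then \sum_i leaf_sum k' v (child i P) else v P.

Lemma leaf_sum_additive k v P : tree_additive v -> leaf_sum k v P = v P.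
Proof.
move=> av; elim: k P => //= k IH P; rewrite [RHS]av.
by apply: eq_bigr => i _; exact: IH.
Qed.

Lemma le_leaf_sum k v v' P : (forall D, v D <= v' D) ->
  leaf_sum k v P <= leaf_sum k v' P.
Proof. by move=> vv'; elim: k P => //= k IH P; apply: ler_sum => i _. Qed.

Lemma leaf_sumD k v v' P :
  leaf_sum k (fun D => v D + v' D) P = leaf_sum k v P + leaf_sum k v' P.
Proof.
by elim: k P => //= k IH P; rewrite -big_split; apply: eq_bigr => i _; exact: IH.
Qed.

Lemma leaf_sumZ k v x P :
  leaf_sum k (fun D => x * v D) P = x * leaf_sum k v P.
Proof.
by elim: k P => //= k IH P; rewrite big_distrr; apply: eq_bigr => i _; exact: IH.
Qed.

Section stopping.
Variables (a : N -> R) (c lam : R).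

(* The part of [v P] carried by the depth-[k] descendants of [P] that are not
   below a node where [a] deviates from [c] by more than [lam]. *)
Fixpoint unstopped (k : nat) (v : N -> R) (P : N) : R :=
  if lam < `|a P - c| then 0
  else if k is k'.+1 then \sum_i unstopped k' v (child i P) else v P.

Lemma unstopped_ge0 k v P : (forall D, 0 <= v D) -> 0 <= unstopped k v P.
Proof.
move=> v0; elim: k P => [|k IH] P /=; case: ifP => // _.
by apply: sumr_ge0 => i _; exact: IH.
Qed.

Lemma unstopped_le k v P : (forall D, 0 <= v D) -> tree_additive v ->
  unstopped k v P <= v P.
Proof.
move=> v0 av; elim: k P => [|k IH] P /=; case: ifP => // _.
by rewrite [leRHS]av; apply: ler_sum => i _; exact: IH.
Qed.

(** Chebyshev's inequality over the stopping nodes: each of them satisfies [lam * m <= M], and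
    additivity sums these bounds. It plays the part of a weak-type maximal estimate at finite
    depth. *)
Lemma stopped_weak_type k m M P : tree_additive m -> tree_additive M ->
  0 <= lam -> (forall D, 0 <= M D) -> (forall D, 0 <= m D) ->
  (forall D, `|a D - c| * m D <= M D) ->
  lam * (m P - unstopped k m P) <= M P.
Proof.
move=> am aM lam0 M0 m0 H; elim: k P => [|k IH] P /=; case: ifPn => [lt|_].
- by rewrite subr0 (le_trans _ (H _))// ler_wpM2r// ltW.
- by rewrite subrr mulr0.
- by rewrite subr0 (le_trans _ (H _))// ler_wpM2r// ltW.
- rewrite [m P]am [leRHS]aM -sumrB mulr_sumr.
  by apply: ler_sum => i _; exact: IH.
Qed.

(** The surviving leaves depend on [a], [c] and [lam] only, so [unstopped] is a sum over a fixed set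
    of leaves, monotone and linear in the summed quantity. *)
Lemma unstopped_lin k (m v v' : N -> R) x y P :
  (forall D, m D <= x * v D + y * v' D) ->
  unstopped k m P <= x * unstopped k v P + y * unstopped k v' P.
Proof.
move=> H; elim: k P => [|k IH] P /=; case: ifPn => // _; rewrite ?mulr0 ?addr0//.
by rewrite !mulr_sumr -big_split; apply: ler_sum => i _; exact: IH.
Qed.

End stopping.

(** Model: for a function [g] with oscillation at most [e], [m] is the volume, [w] and [s] are the
    masses of a weight and of its dual, [a] is the average of [g], and [M c P] is the integral of
    [|g - c|] over [P]. *)
Variables (m w s a : N -> R) (M : R -> N -> R).
Variables (e D b A : R).
Hypothesis m_gt0 : forall P, 0 < m P.
Hypothesis w_ge0 : forall P, 0 <= w P.
Hypothesis s_gt0 : forall P, 0 < s P.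
Hypothesis m_add : tree_additive m.
Hypothesis w_add : tree_additive w.
Hypothesis s_add : tree_additive s.
Hypothesis M_add : forall c, tree_additive (M c).
Hypothesis M_ge0 : forall c P, 0 <= M c P.
Hypothesis M_avg : forall c P, `|a P - c| * m P <= M c P.
Hypothesis M_osc : forall P, M (a P) P <= e * m P.
Hypothesis m_child : forall i P, m P <= D * m (child i P).
Hypothesis e_gt0 : 0 < e.
Hypothesis b_gt0 : 0 < b.
Hypothesis A_ge1 : 1 <= A.
Hypothesis m_young : forall t P, 0 < t -> m P <= t * w P + t `^ (- b) * s P.
Hypothesis ws_le : forall P, w P / m P * (s P / m P) `^ b^-1 <= A.

(* The proportion of the [w]-mass of a node that survives the stopping. *)
Definition jn_const : R := (4 * 4 `^ b^-1 * A)^-1.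
Hypothesis small : (2 + D) * e <= ln (1 + jn_const / 2).

Let kappa_gt0 : 0 < jn_const.
Proof.
by rewrite /jn_const invr_gt0 !mulr_gt0// ?powR_gt0// (lt_le_trans _ A_ge1).
Qed.

Let kappa_le1 : jn_const <= 1.
Proof.
rewrite /jn_const invf_le1; last by rewrite -invr_gt0.
have h4 : 1 <= (4 : R) `^ b^-1.
  by rewrite -[leLHS](powRr0 4) ler_powR ?invr_ge0 ?ler1n ?(ltW b_gt0).
rewrite -[leLHS]mulr1 ler_pM ?ler01//; nra.
Qed.

(** A child holds at least the fraction [1 / D] of the volume, so averaging [|g - a P|] over it
    instead of over [P] costs at most a factor [D]. *)
Let step i P : `|a (child i P) - a P| <= D * e.
Proof.
rewrite -(ler_pM2r (m_gt0 (child i P))).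
rewrite (le_trans (M_avg (a P) _))//.
apply: (@le_trans _ _ (M (a P) P)).
  by rewrite [leRHS]M_add (bigD1 i)//= lerDl sumr_ge0.
rewrite (le_trans (M_osc P))// mulrAC [leRHS]mulrC ler_wpM2l //; exact: ltW.
Qed.

(** With threshold [2 * e] at most half of the volume is stopped. Young's inequality converts the
    surviving half into [w]-mass plus a dual term that the choice of [t] makes harmless. *)
Let w_unstopped k P : jn_const * w P <= unstopped (a) (a P) (2 * e) k w P.
Proof.
set G := unstopped a (a P) (2 * e) k.
have half : m P / 2 <= G m P.
  have e2 : 0 < 2 * e by rewrite mulr_gt0.
  have := @stopped_weak_type a (a P) (2 * e) k m (M (a P)) P m_add (M_add _)
    (ltW e2) (M_ge0 _) (fun D => ltW (m_gt0 D)) (M_avg (a P)).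
  rewrite -/G => /le_trans/(_ (M_osc P)).
  rewrite -mulrA mulrCA ler_pM2l//; lra.
pose t := (4 * (s P / m P)) `^ b^-1.
have t0 : 0 < t.
  by apply: powR_gt0; rewrite mulr_gt0// divr_gt0.
have tb : t `^ (- b) * s P = m P / 4.
  have q0 : 0 <= 4 * (s P / m P) by rewrite mulr_ge0// ltW// divr_gt0.
  by rewrite /t -powRrM mulrN mulVf ?gt_eqF// powR_inv1//; field; rewrite !gt_eqF.
have H1 : G m P <= t * G w P + t `^ (- b) * G s P.
  apply: unstopped_lin => Q; exact: m_young.
have H2 : G s P <= s P by apply: unstopped_le => // Q; exact: ltW.
have H3 : t `^ (- b) * G s P <= m P / 4.
  by rewrite -tb; apply: ler_wpM2l => //; exact: powR_ge0.
have H4 : m P / 4 <= t * G w P by lra.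
rewrite -(ler_pM2l t0) (le_trans _ H4)//.
have := ws_le P; rewrite -(ler_pM2l (m_gt0 P)) => H5.
have tE : t = 4 `^ b^-1 * (s P / m P) `^ b^-1.
  by rewrite /t powRM// divr_ge0// ltW.
rewrite mulrCA.
have -> : t * w P = 4 `^ b^-1 * (m P * (w P / m P * (s P / m P) `^ b^-1)).
  by rewrite tE; field; rewrite gt_eqF.
rewrite /jn_const ler_pdivrMl; last by rewrite -invr_gt0.
have -> : 4 * 4 `^ b^-1 * A * (m P / 4) = 4 `^ b^-1 * (m P * A) by field.
by rewrite ler_wpM2l// powR_ge0.
Qed.

(** Write [kappa] for [jn_const]. Surviving leaves contribute at most [2 * w P]. Below a stopping
    node the inductive bound restarts, at the price of a factor at most [1 + kappa / 2], on a mass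
    of at most [(1 - kappa) * w P]. Since [(1 + kappa / 2) * (1 - kappa) <= 1 - kappa / 2], the
    induction closes as soon as [K * kappa / 2 >= 2]: hence [K = 4 / kappa]. *)
Lemma tree_john_nirenberg k P :
  leaf_sum k (fun Q => expR `|a Q - a P| * w Q) P <= 4 / jn_const * w P.
Proof.
set K := 4 / _; have K1 : 4 <= K.
  by rewrite /K ler_pdivlMr// ler_piMr.
have sm := small; have kap0 := kappa_gt0; have kap1 := kappa_le1.
have wu := w_unstopped.
set kap := jn_const in sm kap0 kap1 wu K K1 *.
have e2 : 0 < 2 * e by rewrite mulr_gt0.
have D0 : 0 <= D.
  case: (leP 0 D) => // Dlt.
  (* A node without children would have [m P = 0]. *)
  have [i _|I0] := pickP (@predT I).
    have := lt_le_trans (m_gt0 P) (m_child i P).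
    by rewrite pmulr_lgt0 ?m_gt0// ltNge (ltW Dlt).
  by have := m_gt0 P; rewrite m_add big_pred0 ?ltxx// => i; have := I0 i.
have eth : expR (2 * e + D * e) <= 1 + kap / 2.
  rewrite -[leRHS]lnK ?posrE; last by lra.
  by rewrite ler_expR -mulrDl.
have ele : expR (2 * e) <= expR (2 * e + D * e).
  by rewrite ler_expR lerDl mulr_ge0// ltW.
elim/ltn_ind: k P => -[_ P|k IH P].
  rewrite /= subrr normr0 expR0 ler_wpM2r//; lra.
set c := a P; pose G := unstopped a c (2 * e).
(* A first stopped node overshoots the threshold by at most one jump [D * e], because its parent was
   not stopped. The bound [j <= k] keeps the subtree below it within reach of the outer
   induction. *)
have main j Q : (j <= k)%N -> `|a Q - c| <= 2 * e + D * e ->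
  leaf_sum j (fun Q => expR `|a Q - c| * w Q) Q <=
  expR (2 * e) * G j w Q + expR (2 * e + D * e) * K * (w Q - G j w Q).
  elim: j Q => [|j IHj] Q jk /= HQ; rewrite /G /=; case: ifPn => stop.
  - rewrite mulr0 add0r subr0 ler_wpM2r// (@le_trans _ _ (expR (2 * e + D * e)))//.
      by rewrite ler_expR.
    by rewrite ler_peMr ?expR_ge0// (le_trans _ K1)// ler1n.
  all: cycle 1.
  all: try by rewrite subrr mulr0 addr0 ler_wpM2r// ler_expR leNgt.
  - rewrite mulr0 add0r subr0.
    have := ler_wpM2l (expR_ge0 (2 * e + D * e)) (IH j.+1 jk Q).
    rewrite mulrA; apply: le_trans => /=.
    rewrite mulr_sumr; apply: ler_sum => i _.
    rewrite -leaf_sumZ; apply: le_leaf_sum => Q'.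
    rewrite mulrA ler_wpM2r// -expRD ler_expR.
    rewrite -(subrKA (a Q)) addrC (le_trans (ler_normD _ _))//.
    by rewrite addrC [_ + _ in leRHS]addrC lerD// addrC.
  - rewrite [w Q]w_add -sumrB !mulr_sumr -big_split; apply: ler_sum => i _.
    apply: IHj; first exact: ltnW.
    rewrite -(subrKA (a Q)) (le_trans (ler_normD _ _))// addrC lerD// ?step//.
    by rewrite leNgt.
have GP := wu k.+1 P; rewrite -/c -/G in GP.
have Glew : G k.+1 w P <= w P by exact: unstopped_le.
have cP : ~~ (2 * e < `|a P - c|) by rewrite subrr normr0 -leNgt ltW.
have G0 : 0 <= G k.+1 w P by apply: unstopped_ge0.
have : leaf_sum k.+1 (fun Q => expR `|a Q - c| * w Q) P <=
  expR (2 * e) * G k.+1 w P + expR (2 * e + D * e) * K * (w P - G k.+1 w P).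
  rewrite /= /G /= (negbTE cP) [w P]w_add -sumrB !mulr_sumr -big_split.
  apply: ler_sum => i _; apply: main => //.
  by rewrite (le_trans (step _ _))// lerDr ltW.
move=> /le_trans; apply.
set E1 := expR (2 * e) in ele *; set E2 := expR (2 * e + _) in eth ele *.
have E10 : 0 < E1 by exact: expR_gt0.
have KE : K * kap = 4 by rewrite /K mulfVK// gt_eqF.
move: (G _ _ _) (w P) (w_ge0 P) GP Glew G0 => g W W0 GP Glew G0.
have h1 : E1 * g <= 2 * W by nra.
have h2 : E2 * K * (W - g) <= (1 + kap / 2) * K * ((1 - kap) * W).
  apply: ler_pM => //; [nra|lra| |lra].
  by rewrite ler_wpM2r//; lra.
have h3 : (1 + kap / 2) * K * ((1 - kap) * W) <= (K - 2) * W.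
  rewrite mulrA ler_wpM2r//.
  have -> : (1 + kap / 2) * K * (1 - kap) = K - K * kap / 2 - K * kap * kap / 2 by field.
  rewrite KE; nra.
nra.
Qed.

End Tree.

(** * Parallel sums of weights *)

Section LebesgueTranslation.
Context {R : realType}.
Local Notation mu := (@lebesgue_measure R).

Lemma measurable_addr (c : R) :
  measurable_fun [set: measurableTypeR R] ((fun x => x + c) : _ -> measurableTypeR R).
Proof. by apply: measurable_funD. Qed.

Lemma lebesgue_measure_shift (c : R) (A : set R) : measurable A ->
  pushforward mu ((fun x => x + c) : _ -> measurableTypeR R) A = mu A.
Proof.
move=> mA; apply/esym/lebesgue_measure_unique => //=.
  exact: measurable_addr.
move=> _ m' [[a b]] _ <-.
rewrite /pushforward.
have -> : (fun x : measurableTypeR R => x + c : measurableTypeR R) @^-1` `]a, b]%classic =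
    `]a - c, b - c]%classic.
  by apply/seteqP; split=> x /=; rewrite !in_itv/= ltrBlDr lerBrDr.
by rewrite !lebesgue_measure_itv/= !lte_fin ltrD2r -!EFinB opprB addrA subrK.
Qed.

Lemma ge0_integral_shift (c : R) (f : R -> \bar R) :
  measurable_fun [set: R] f -> (forall r, 0 <= f r)%E ->
  (\int[mu]_x f (x + c)%R = \int[mu]_x f x)%E.
Proof.
move=> mf f0.
have mc := measurable_addr c.
have := @ge0_integral_pushforward _ _ (measurableTypeR R) (measurableTypeR R) R
   _ mc mu setT f measurableT mf (fun x _ => f0 x).
rewrite preimage_setT => <-.
by apply: eq_measure_integral => A mA _; rewrite -[RHS](lebesgue_measure_shift c).
Qed.

End LebesgueTranslation.

Section ParallelSum.
Context {R : realType}.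
Variable p : R.
Hypothesis p1 : 1 < p.
Local Notation q := (p - 1)^-1.
Implicit Types a b c z t u : R.

(* Parallel sum of the weights [expR a] and [expR b]: the least value of
   [z0 `^ p * expR a + z1 `^ p * expR b] under [z0 + z1 = 1]. *)
Definition psum a b : R :=
  expR ((1 - p) * ln (expR (- (q * a)) + expR (- (q * b)))).

(** The minimizing [z0] in the variational description of [psum]. *)
Definition psplit a b : R :=
  expR (- (q * a)) / (expR (- (q * a)) + expR (- (q * b))).

Let p10 : p - 1 != 0. Proof. by rewrite subr_eq0 gt_eqF. Qed.
Let p_gt0 : 0 < p. Proof. exact: lt_trans p1. Qed.
Let p10' : 0 < p - 1. Proof. by rewrite subr_gt0. Qed.
Let S_gt0 a b : 0 < expR (- (q * a)) + expR (- (q * b)).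
Proof. by rewrite addr_gt0 ?expR_gt0. Qed.

Lemma psum_gt0 a b : 0 < psum a b. Proof. exact: expR_gt0. Qed.

Lemma psumC a b : psum a b = psum b a.
Proof. by rewrite /psum (addrC (expR _)). Qed.

Lemma psum_lel a b : psum a b <= expR a.
Proof.
rewrite ler_expR -opprB mulNr lerNl -[leLHS](mulVKf p10) ler_pM2l// mulrN.
by rewrite -[leLHS]expRK ler_ln ?posrE ?expR_gt0 ?S_gt0 ?lerDl ?expR_ge0.
Qed.

Lemma psum_ler a b : psum a b <= expR b.
Proof. by rewrite psumC psum_lel. Qed.

Lemma psum_shift a b c : psum (a + c) (b + c) = expR c * psum a b.
Proof.
rewrite /psum !mulrDr !opprD !expRD -mulrDl lnM ?posrE ?expR_gt0 ?S_gt0//.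
by rewrite expRK -expRD; congr expR; field.
Qed.

Lemma psplit_ge0 a b : 0 <= psplit a b.
Proof. by rewrite divr_ge0 ?expR_ge0// ltW. Qed.

Lemma psplitC a b : psplit b a = 1 - psplit a b.
Proof.
rewrite /psplit [in LHS](addrC (expR (- (q * b)))).
by apply/eqP; rewrite eq_sym subr_eq -mulrDl addrC divff// gt_eqF.
Qed.

Lemma psum_split a b :
  psplit a b `^ p * expR a + (1 - psplit a b) `^ p * expR b = psum a b.
Proof.
have H x y : psplit x y `^ p * expR x =
    expR (- p * ln (expR (- (q * x)) + expR (- (q * y)))) * expR (- (q * x)).
  rewrite /psplit; set S := expR _ + expR _.
  have S0 : 0 < S by exact: S_gt0.
  rewrite -{1}[S]lnK ?posrE// -expRN -expRD -expRM -!expRD.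
  congr expR; field; exact: p10.
rewrite -psplitC !H (addrC (expR (- (q * b)))) -mulrDr /psum.
set S := expR _ + expR _.
rewrite -{2}[S]lnK ?posrE// ?S_gt0// -expRD; congr expR; ring.
Qed.

(** Two-term Hölder inequality for [z0 + z1], with each summand written as
    [(expR (a / p) * z0) * expR (- (a / p))]. *)
Lemma psum_le z z0 z1 a b : 0 <= z -> 0 <= z0 -> 0 <= z1 -> z <= z0 + z1 ->
  z `^ p * psum a b <= z0 `^ p * expR a + z1 `^ p * expR b.
Proof.
move=> z_0 z00 z10 zz.
pose p' := p / (p - 1).
have p'0 : 0 < p' by rewrite divr_gt0.
have pp' : p^-1 + p'^-1 = 1 by rewrite /p'; field; rewrite p10 gt_eqF.
have powe x y : 0 <= y -> (expR (x / p) * y) `^ p = expR x * y `^ p.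
  by move=> y0; rewrite powRM ?expR_ge0// -expRM divfK// gt_eqF.
have powe' x : expR (- (x / p)) `^ p' = expR (- (q * x)).
  rewrite -expRM; congr expR; rewrite /p'; field.
  by rewrite p10 gt_eqF.
have := hoelder2 (mulr_ge0 (expR_ge0 (a / p)) z00) (mulr_ge0 (expR_ge0 (b / p)) z10)
  (expR_ge0 (- (a / p))) (expR_ge0 (- (b / p))) p_gt0 p'0 pp'.
rewrite (powe _ _ z00) (powe _ _ z10) !powe'.
have eK x y : expR x * y * expR (- x) = y by rewrite mulrAC expRxMexpNx_1 mul1r.
rewrite !eK; set X := expR a * _ + expR b * _; set S := expR (- _) + expR _ => H.
have S0 : 0 < S by exact: S_gt0.
have X0 : 0 <= X by rewrite addr_ge0// mulr_ge0 ?expR_ge0 ?powR_ge0.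
have {}H : z `^ p <= X * expR ((p - 1) * ln S).
  apply: (@le_trans _ _ ((X `^ p^-1 * S `^ p'^-1) `^ p)).
    rewrite ge0_ler_powR ?nnegrE ?mulr_ge0 ?powR_ge0//; first exact: ltW.
    exact: le_trans H.
  rewrite powRM ?powR_ge0// -!powRrM mulVf ?gt_eqF// powRr1//.
  rewrite -{1}[S]lnK ?posrE// -expRM ler_wpM2l// ler_expR [leLHS]mulrC.
  by rewrite le_eqVlt; apply/orP; left; apply/eqP; rewrite /p'; field; rewrite p10 gt_eqF.
apply: (@le_trans _ _ (X * expR ((p - 1) * ln S) * psum a b)).
  by rewrite ler_wpM2r// ltW// psum_gt0.
rewrite -mulrA -expRD -/S -mulrDl addrC subrKA subrr mul0r expR0 mulr1.
by rewrite /X ![expR _ * _]mulrC.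
Qed.

Definition pkernel t u : R := expR (- (t * u)) * psum 0 u.

Lemma pkernel_gt0 t u : 0 < pkernel t u.
Proof. by rewrite mulr_gt0 ?expR_gt0. Qed.

(** Homogeneity of the parallel sum extracts [expR a], and translating [u] by [b - a] extracts
    [expR (t * (b - a))]. After integration in [u] only this product of powers still depends on [a]
    and [b]. *)
Lemma pkernelE t a b u : expR (- (t * u)) * psum a (b + u) =
  expR ((1 - t) * a + t * b) * pkernel t (u + (b - a)).
Proof.
rewrite /pkernel mulrA -expRD.
have -> : psum a (b + u) = expR a * psum 0 (u + (b - a)).
  by rewrite -psum_shift add0r; congr psum; ring.
by rewrite mulrA -expRD; congr (expR _ * _); ring.
Qed.

Lemma measurable_psum d (T : measurableType d) (f g : T -> R) :
  measurable_fun [set: T] f -> measurable_fun [set: T] g ->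
  measurable_fun [set: T] (fun x => psum (f x) (g x)).
Proof.
move=> mf mg; apply: measurableT_comp => //; apply: measurable_funM => //.
apply: measurableT_comp; first exact: measurable_ln.
by apply: measurable_funD; apply: measurableT_comp => //;
  apply: measurableT_comp => //; apply: measurable_funM.
Qed.

Lemma measurable_pkernel t : measurable_fun [set: R] (pkernel t).
Proof.
apply: measurable_funM; last exact: measurable_psum.
by apply: measurableT_comp => //; apply: measurableT_comp => //; apply: measurable_funM.
Qed.

(** [psum 0 u] is at most 1 and at most [expR u]; the first bound is used for [u >= 0], the second
    for [u < 0]. *)
Lemma pkernel_le t u : 0 < t -> t < 1 ->
  pkernel t u <= expR (- (Num.min t (1 - t) * `|u|)).
Proof.
move=> t0 t1.
have m1 : Num.min t (1 - t) <= t by rewrite ge_min lexx.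
have m2 : Num.min t (1 - t) <= 1 - t by rewrite ge_min lexx orbT.
have [u0|u0] := leP 0 u.
  rewrite -[leRHS]mulr1 -[X in _ * X](@expR0 R).
  apply: ler_pM; [exact: expR_ge0|exact/ltW/psum_gt0| |exact: psum_lel].
  by rewrite ler_expR lerN2 ger0_norm// ler_wpM2r.
apply: (@le_trans _ _ (expR (- (t * u)) * expR u)).
  by rewrite ler_wpM2l ?expR_ge0// psum_ler.
rewrite -expRD ler_expR ltr0_norm//; nra.
Qed.

Definition pconst t : \bar R := (\int[lebesgue_measure]_u (pkernel t u)%:E)%E.

Lemma integral_psum t a b :
  (\int[lebesgue_measure]_u (expR (- (t * u)) * psum a (b + u))%:E =
   (expR ((1 - t) * a + t * b))%:E * pconst t)%E.
Proof.
under eq_integral do rewrite pkernelE EFinM.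
have mk : measurable_fun [set: R] (EFin \o pkernel t).
  by apply/measurable_EFinP; exact: measurable_pkernel.
have mk' : measurable_fun [set: R] (fun u => (pkernel t (u + (b - a)))%:E).
  apply: (measurableT_comp mk).
  by apply: measurable_funD.
have k0 u : (0 <= (pkernel t u)%:E)%E by rewrite lee_fin ltW// pkernel_gt0.
have E : (\int[lebesgue_measure]_u (pkernel t (u + (b - a)))%:E = pconst t)%E.
  by apply: (@ge0_integral_shift R (b - a) (EFin \o pkernel t) mk).
rewrite -E.
apply: ge0_integralZl_EFin.
- exact: measurableT.
- by move=> u _; exact: k0.
- exact: mk'.
- exact: expR_ge0.
Qed.

Lemma pconst_gt0 t : (0 < pconst t)%E.
Proof.
rewrite lt0e; apply/andP; split; last first.
  by apply: integral_ge0 => u _; rewrite lee_fin ltW// pkernel_gt0.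
apply/eqP => I0.
have mk : measurable_fun [set: R] (EFin \o pkernel t).
  by apply/measurable_EFinP; exact: measurable_pkernel.
have : (\int[@lebesgue_measure R]_u `|(pkernel t u)%:E| = 0)%E.
  rewrite -[RHS]I0; apply: eq_integral => u _.
  by rewrite gee0_abs// lee_fin ltW// pkernel_gt0.
move/(ae_eq_integral_abs (@lebesgue_measure R) measurableT mk) => -[N [mN N0 sub]].
have : setT `<=` N.
  apply: subset_trans sub => u _ /=.
  move=> /(_ I) /eqP; rewrite eqe gt_eqF// pkernel_gt0//.
move=> TN.
have : (lebesgue_measure `[0%R, 1%R]%classic <= lebesgue_measure N :> \bar R)%E.
  by apply: le_measure; rewrite ?inE//; exact: subset_trans TN.
by rewrite N0 lebesgue_measure_itv/= lte01 oppr0 adde0 lee_fin ler10.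
Qed.

Lemma pconst_lty t : 0 < t -> t < 1 -> (pconst t < +oo)%E.
Proof.
move=> t0 t1.
set m := Num.min t (1 - t).
have m0 : 0 < m by rewrite lt_min t0 subr_gt0.
pose h (u : R) := m^-1 * (exponential_pdf m u + exponential_pdf m (- u)).
have mE := measurable_exponential_pdf m.
have mEN : measurable_fun setT (fun u => exponential_pdf m (- u)).
  by apply: measurableT_comp.
have E0 u : 0 <= exponential_pdf m u by apply: exponential_pdf_ge0; exact: ltW.
have kh u : pkernel t u <= h u.
  apply: (le_trans (pkernel_le _ t0 t1)); rewrite -/m /h.
  rewrite ler_pdivlMl//.
  have [u0|u0] := leP 0 u.
    by rewrite ger0_norm// exponential_pdfE// mulNr lerDl.
  by rewrite ltr0_norm// [X in _ + X]exponential_pdfE ?mulNr ?lerDr// oppr_ge0 ltW.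
have INT : (\int[@lebesgue_measure R]_u (exponential_pdf m (- u))%:E = 1)%E.
  rewrite -(integral_exponential_pdf m0).
  have mfE : measurable_fun setT (EFin \o exponential_pdf m).
    exact/measurable_EFinP.
  have mN : measurable_fun setT ((fun x => - x) : measurableTypeR R -> measurableTypeR R).
    exact: oppr_measurable.
  have := @ge0_integral_pushforward _ _ (measurableTypeR R) (measurableTypeR R) R
   _ mN lebesgue_measure setT (EFin \o exponential_pdf m) measurableT mfE
   (fun x _ => E0 x).
  rewrite preimage_setT => <-.
  apply: eq_measure_integral => //= A mA _; exact: lebesgue_measureN.
apply: (@le_lt_trans _ _ (\int[@lebesgue_measure R]_u (h u)%:E)%E).
  apply: ge0_le_integral => //.
  - by move=> u _; rewrite lee_fin ltW// pkernel_gt0.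
  - by apply/measurable_EFinP; exact: measurable_pkernel.
  - by apply/measurable_EFinP/measurable_funM => //; apply: measurable_funD.
  - by move=> u _; rewrite lee_fin.
rewrite /h; under eq_integral do rewrite EFinM EFinD.
rewrite ge0_integralZl_EFin ?invr_ge0 ?(ltW m0)//.
- rewrite ge0_integralD//.
  + by rewrite INT integral_exponential_pdf// -EFinD -EFinM ltry.
  + by move=> u _; rewrite lee_fin.
  + exact/measurable_EFinP.
  + by move=> u _; rewrite lee_fin.
  + exact/measurable_EFinP.
- by move=> u _; rewrite -EFinD lee_fin addr_ge0.
- by apply: emeasurable_funD; apply/measurable_EFinP.
Qed.

End ParallelSum.

(** * Weighted norms of operators *)

Section Scalars.
Context {R : realType} {s : scalars}.
Implicit Types (z : scalar R s) (x y : R).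

(** Splitting coefficients and cut-offs are real functions; they multiply scalar-valued functions
    through this map. *)
Definition embed : R -> scalar R s :=
  match s return R -> scalar R s with
  | RealScalars => fun x => x
  | ComplexScalars => fun x => Complex x 0
  end.

Lemma modulus_ge0 z : 0 <= modulus z.
Proof. by case: s z => [|] z /=; [exact: normr_ge0|case: z => x y; exact: sqrtr_ge0]. Qed.

Lemma modulusD z z' : modulus (z + z') <= modulus z + modulus z'.
Proof. by case: s z z' => [|] z z' /=; [exact: ler_normD|exact: le_normcD]. Qed.

Lemma modulusM z z' : modulus (z * z') = modulus z * modulus z'.
Proof. by case: s z z' => [|] z z' /=; [exact: normrM|exact: ComplexField.Normc.normcM]. Qed.

Lemma modulus_embed x : modulus (embed x) = `|x|.
Proof. by rewrite /embed; case: s => //=; rewrite expr0n/= addr0 sqrtr_sqr. Qed.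

Lemma embedD x y : embed (x + y) = embed x + embed y.
Proof. by rewrite /embed; case: s => //; rewrite -[RHS]/(Complex (x + y) (0 + 0)) addr0. Qed.

Lemma embed1 : embed 1 = 1.
Proof. by rewrite /embed; case: s. Qed.

Context {n : nat}.
Implicit Types (f : n.-tuple R -> scalar R s) (h : n.-tuple R -> R).

Lemma measurable_modulus f : scalar_measurable f ->
  measurable_fun [set: n.-tuple R] (fun x : n.-tuple R => modulus (f x)).
Proof.
case: s f => [|] f /=.
  by move=> mf; exact: (measurableT_comp (@normr_measurable R setT) mf).
move=> [mr mi].
have -> : (fun x : n.-tuple R => ComplexField.Normc.normc (f x)) =
    (fun x : n.-tuple R => (complex.Re (f x) ^+ 2 + complex.Im (f x) ^+ 2) `^ 2^-1).
  by apply/funext => x; rewrite powR12_sqrt ?addr_ge0 ?sqr_ge0//; case: (f x).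
apply: (measurableT_comp (measurable_powR _)).
by apply: measurable_funD; apply: measurable_funX.
Qed.

Lemma scalar_measurable_embedM f h : scalar_measurable f ->
  measurable_fun [set: n.-tuple R] h ->
  scalar_measurable (fun x : n.-tuple R => embed (h x) * f x).
Proof.
rewrite /embed; case: s f => [|] f /=.
  by move=> mf mh; apply: measurable_funM.
move=> [mr mi] mh; split.
- have -> : (fun x : n.-tuple R => complex.Re (Complex (h x) 0 * f x)) =
      (fun x : n.-tuple R => h x * complex.Re (f x)).
    by apply/funext => x; case: (f x) => u v /=; rewrite mul0r subr0.
  by apply: measurable_funM.
- have -> : (fun x : n.-tuple R => complex.Im (Complex (h x) 0 * f x)) =
      (fun x : n.-tuple R => h x * complex.Im (f x)).
    by apply/funext => x; case: (f x) => u v /=; rewrite mul0r addr0.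
  exact: measurable_funM.
Qed.

End Scalars.

Lemma lee_poweR (R : realType) (x y : \bar R) (r : R) :
  0 <= r -> (0 <= x)%E -> (x <= y)%E -> (x `^ r <= y `^ r)%E.
Proof.
move=> r0 x0 xy; apply: gt0_ler_poweR => //; rewrite in_itv/= leey andbT//.
exact: le_trans xy.
Qed.

Lemma ae_imply (R : realType) (n : nat) (P Q : n.-tuple R -> Prop) :
  {ae lebesgue_measure_tuple n, forall x, P x} -> (forall x, P x -> Q x) ->
  {ae lebesgue_measure_tuple n, forall x, Q x}.
Proof.
by move=> [N [mN N0 sub]] PQ; exists N; split=> //;
  apply: subset_trans sub; apply: subsetC => x; exact: PQ.
Qed.

Section PNorm.
Context {R : realType} {s : scalars} {n : nat}.
Local Notation mu := (@lebesgue_measure_tuple R n).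
Local Notation fct := (n.-tuple R -> scalar R s).
Variable p : R.
Hypothesis p1 : 1 < p.
Implicit Types (f g : fct) (w : n.-tuple R -> R) (T : operator R s n).

Let p_gt0 : 0 < p. Proof. exact: lt_trans p1. Qed.
Let p_neq0 : p != 0. Proof. by rewrite gt_eqF. Qed.

(** The [p]-th power of [Lp_norm]: without the root, contributions of different weights simply add
    up. *)
Definition pint w f : \bar R := (\int[mu]_x (modulus (f x) `^ p * w x)%:E)%E.

Lemma measurable_pint w f : scalar_measurable f ->
  measurable_fun [set: n.-tuple R] w ->
  measurable_fun [set: n.-tuple R] (fun x : n.-tuple R => modulus (f x) `^ p * w x).
Proof.
move=> mf mw; apply: measurable_funM => //.
apply: (measurableT_comp (measurable_powR p)); exact: measurable_modulus.
Qed.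

Lemma pint_ge0 w f : (forall x, 0 <= w x) -> (0 <= pint w f)%E.
Proof.
by move=> w0; apply: integral_ge0 => x _; rewrite lee_fin mulr_ge0// powR_ge0.
Qed.

Lemma Lp_spaceE w f : (forall x, 0 <= w x) ->
  Lp_space p w f <-> scalar_measurable f /\ (pint w f < +oo)%E.
Proof.
move=> w0; rewrite /Lp_space /Lp_norm /= -/(pint w f); split=> -[mf H]; split=> //.
  by move: H; apply: lty_poweRy; rewrite invr_eq0.
exact: poweR_lty.
Qed.

Lemma Lp_norm_leP w f g (K : R) : (forall x, 0 <= w x) -> 0 <= K ->
  (Lp_norm p w f <= K%:E * Lp_norm p w g)%E <->
  (pint w f <= (K `^ p)%:E * pint w g)%E.
Proof.
move=> w0 K0; rewrite /Lp_norm -/(pint w f) -/(pint w g).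
move: (pint w f) (pint w g) (pint_ge0 f w0) (pint_ge0 g w0) => X Y X0 Y0.
have Kp : (K%:E = ((K `^ p)%:E `^ p^-1))%E.
  by rewrite poweR_EFin -powRrM divff// powRr1.
have E : (K%:E * Y `^ p^-1 = ((K `^ p)%:E * Y) `^ p^-1)%E.
  by rewrite {1}Kp poweRM// lee_fin powR_ge0.
have ip : 0 <= p^-1 by rewrite invr_ge0 ltW.
have KG0 : (0 <= (K `^ p)%:E * Y)%E by rewrite mule_ge0// lee_fin powR_ge0.
rewrite E; split => H.
  have : ((X `^ p^-1) `^ p <= (((K `^ p)%:E * Y) `^ p^-1) `^ p)%E.
    by apply: lee_poweR; rewrite ?poweR_ge0// ltW.
  by rewrite -!poweRrM mulVf// !poweRe1.
by apply: lee_poweR.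
Qed.

Lemma opnorm_ge0 w T : (0 <= opnorm p w T)%E.
Proof. by apply: le_ereal_inf_tmp => _ [K [K0 _] <-]; rewrite lee_fin. Qed.

(** The infimum defining [opnorm] is attained: letting admissible constants decrease to it preserves
    the inequality for each fixed [f]. *)
Lemma opnorm_leP w T (K : R) : (forall x, 0 <= w x) -> 0 <= K ->
  (opnorm p w T <= K%:E)%E <->
  (forall f, Lp_space p w f -> (pint w (T f) <= (K `^ p)%:E * pint w f)%E).
Proof.
move=> w0 K0; split=> [H f Lf|H]; last first.
  apply: ereal_inf_lbound; exists K => //; split => // f Lf.
  by apply/Lp_norm_leP => //; exact: H.
apply/Lp_norm_leP => //.
have nf0 : (0 <= Lp_norm p w f)%E by exact: poweR_ge0.
have [_ fy] := Lf.
have ffin : Lp_norm p w f \is a fin_num by rewrite ge0_fin_numE.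
rewrite -(fineK ffin) -EFinM; apply/lee_addgt0Pr => e e0.
have /ereal_inf_lt [_ [K' [K'0 HK'] <-]] :
    (* The slack times the norm of [f] stays below [e]; the added 1 covers a vanishing norm. *)
    (opnorm p w T < (K + e / (fine (Lp_norm p w f) + 1))%:E)%E.
  rewrite (le_lt_trans H)// lte_fin ltrDl divr_gt0// ltr_wpDl// fine_ge0//.
rewrite lte_fin => K'lt.
apply: (le_trans (HK' _ Lf)).
rewrite -{1}(fineK ffin) -EFinM -EFinD lee_fin.
set N := fine _; have N0 : 0 <= N by rewrite fine_ge0.
have N1 : 0 < N + 1 by rewrite ltr_wpDl.
apply: (@le_trans _ _ ((K + e / (N + 1)) * N)); first by rewrite ler_wpM2r// ltW.
by rewrite mulrDl lerD2l mulrAC ler_pdivrMr// ler_wpM2l ?(ltW e0)// lerDl ler01.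
Qed.

Lemma eq_Lp_norm w w' f : measurable_fun [set: n.-tuple R] w ->
  measurable_fun [set: n.-tuple R] w' -> scalar_measurable f ->
  {ae mu, forall x, w x = w' x} -> Lp_norm p w f = Lp_norm p w' f.
Proof.
move=> mw mw' mf ww'; rewrite /Lp_norm; congr (_ `^ _)%E.
apply: ae_eq_integral => //.
- by apply/measurable_EFinP; exact: measurable_pint.
- by apply/measurable_EFinP; exact: measurable_pint.
by apply: (ae_imply ww') => x -> _.
Qed.

Lemma eq_Lp_space w w' : measurable_fun [set: n.-tuple R] w ->
  measurable_fun [set: n.-tuple R] w' ->
  {ae mu, forall x, w x = w' x} -> @Lp_space R s n p w = Lp_space p w'.
Proof.
move=> mw mw' ww'; apply/seteqP; split => f [mf]; split=> //.
  by rewrite -(eq_Lp_norm mw mw' mf ww').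
by rewrite (eq_Lp_norm mw mw' mf ww').
Qed.

Lemma eq_opnorm w w' T : measurable_fun [set: n.-tuple R] w ->
  measurable_fun [set: n.-tuple R] w' ->
  (forall f, Lp_space p w f -> scalar_measurable (T f)) ->
  {ae mu, forall x, w x = w' x} -> opnorm p w T = opnorm p w' T.
Proof.
move=> mw mw' mT ww'; rewrite /opnorm -(eq_Lp_space mw mw' ww'); congr ereal_inf.
apply/seteqP; split => _ [K [K0 H] <-]; exists K => //; split => // f Lf.
  rewrite -(eq_Lp_norm mw mw' (mT _ Lf) ww').
  by rewrite -(eq_Lp_norm mw mw' Lf.1 ww'); exact: H.
rewrite (eq_Lp_norm mw mw' (mT _ Lf) ww').
by rewrite (eq_Lp_norm mw mw' Lf.1 ww'); exact: H.
Qed.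

End PNorm.

(** * Recovering [w0^(1-t) w1^t] from parallel sums by Tonelli's theorem *)

Section Interpolation.
Context {R : realType} {s : scalars} {n : nat}.
Local Notation mu := (@lebesgue_measure_tuple R n).
Local Notation fct := (n.-tuple R -> scalar R s).
Variable p : R.
Hypothesis p1 : 1 < p.
Implicit Types (f g : fct) (a b : n.-tuple R -> R).

Lemma measurable_integral_psum (h a b : n.-tuple R -> R) (t : R) :
  measurable_fun [set: n.-tuple R] h -> measurable_fun [set: n.-tuple R] a ->
  measurable_fun [set: n.-tuple R] b -> (forall x, 0 <= h x) ->
  measurable_fun [set: measurableTypeR R] (fun u : R => ((expR (- (t * u)))%:E *
     \int[mu]_x (h x * psum p (a x) (b x + u))%:E)%E).
Proof.
move=> mh ma mb h0; apply: emeasurable_funM.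
  by apply/measurable_EFinP; apply: measurableT_comp => //; apply: measurableT_comp.
have := @measurable_fun_fubini_tonelli_G _ _ _ (measurableTypeR R) R mu
  (fun z : n.-tuple R * measurableTypeR R => (h z.1 * psum p (a z.1) (b z.1 + z.2))%:E).
apply.
- apply/measurable_EFinP.
  apply: measurable_funM; first exact: measurableT_comp.
  apply: measurable_psum; first exact: measurableT_comp.
  by apply: measurable_funD => //; exact: measurableT_comp.
- by move=> z; rewrite lee_fin mulr_ge0// ltW// psum_gt0.
Qed.

Lemma integral_psum_mix (h a b : n.-tuple R -> R) (t : R) :
  measurable_fun [set: n.-tuple R] h -> measurable_fun [set: n.-tuple R] a ->
  measurable_fun [set: n.-tuple R] b -> (forall x, 0 <= h x) ->
  (\int[lebesgue_measure]_u ((expR (- (t * u)))%:E *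
     \int[mu]_x (h x * psum p (a x) (b x + u))%:E) =
   pconst p t * \int[mu]_x (h x * expR ((1 - t) * a x + t * b x))%:E)%E.
Proof.
move=> mh ma mb h0.
have m1 : measurable_fun [set: n.-tuple R * R]
    (fun z : n.-tuple R * R => expR (- (t * z.2)) * (h z.1 * psum p (a z.1) (b z.1 + z.2))).
  apply: measurable_funM.
    apply: measurableT_comp => //; apply: measurableT_comp => //.
    exact: measurable_funM.
  apply: measurable_funM; first exact: measurableT_comp.
  apply: measurable_psum; first exact: measurableT_comp.
  by apply: measurable_funD => //; exact: measurableT_comp.
have m2 (x : n.-tuple R) : measurable_fun [set: R]
    (fun u => expR (- (t * u)) * psum p (a x) (b x + u)).
  apply: measurable_funM.
    apply: measurableT_comp => //; apply: measurableT_comp => //.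
  by apply: measurable_psum => //; apply: measurable_funD.
have nn (x : n.-tuple R) u : 0 <= h x * psum p (a x) (b x + u).
  by rewrite mulr_ge0// ltW// psum_gt0.
transitivity (\int[lebesgue_measure]_u \int[mu]_x
   (expR (- (t * u)) * (h x * psum p (a x) (b x + u)))%:E)%E.
  apply: eq_integral => u _.
  under [RHS]eq_integral do rewrite EFinM.
  rewrite ge0_integralZl_EFin ?expR_ge0//.
    by move=> x _; rewrite lee_fin.
  apply/measurable_EFinP; apply: measurable_funM => //.
  by apply: measurable_psum => //; apply: measurable_funD.
have := @fubini_tonelli _ _ _ _ R mu (@lebesgue_measure R)
  (fun z : n.-tuple R * R => (expR (- (t * z.2)) * (h z.1 * psum p (a z.1) (b z.1 + z.2)))%:E).
move=> /= <-.
- rewrite -ge0_integralZl//.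
  + apply: eq_integral => x _.
    under eq_integral do rewrite mulrCA EFinM.
    rewrite ge0_integralZl_EFin//=.
    * by rewrite integral_psum// muleA -EFinM muleC.
    * by move=> u _; rewrite lee_fin mulr_ge0 ?expR_ge0// ltW// psum_gt0.
    * by apply/measurable_EFinP; exact: m2.
  + apply/measurable_EFinP; apply: measurable_funM => //.
    apply: measurableT_comp => //.
    by apply: measurable_funD; apply: measurable_funM.
  + by move=> x _; rewrite lee_fin mulr_ge0// expR_ge0.
  + by rewrite ltW// pconst_gt0.
- exact/measurable_EFinP.
- by move=> z; rewrite lee_fin mulr_ge0// expR_ge0.
Qed.

End Interpolation.

(** * Interpolation with change of measure *)

Section SteinWeiss.
Context {R : realType} {s : scalars} {n : nat}.
Local Notation mu := (@lebesgue_measure_tuple R n).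
Local Notation fct := (n.-tuple R -> scalar R s).
Variable p : R.
Hypothesis p1 : 1 < p.
Implicit Types (f g h : fct) (w a b : n.-tuple R -> R) (T : operator R s n).

Let p_gt0 : 0 < p. Proof. exact: lt_trans p1. Qed.

(** A parallel sum lies below both weights, hence below their weighted geometric means. *)
Lemma psum_le_mix (x y t : R) : 0 <= t -> t <= 1 ->
  psum p x y <= expR ((1 - t) * x + t * y).
Proof.
move=> t0 t1; have := psum_lel p1 x y; have := psum_ler p1 x y.
rewrite /psum !ler_expR; nra.
Qed.

(** Operators are partial, so domain and measurability travel together with the bound. *)
Definition bounded_on T w (M : R) := [/\ Lp_space p w `<=` op_dom T,
  forall f, Lp_space p w f -> scalar_measurable (T f) &
  forall f, Lp_space p w f -> (pint p w (T f) <= (M `^ p)%:E * pint p w f)%E].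

Lemma Lp_space_expP a f : Lp_space p (fun x => expR (a x)) f <->
  scalar_measurable f /\ (pint p (fun x => expR (a x)) f < +oo)%E.
Proof. exact: (Lp_spaceE p1 f (fun x => expR_ge0 (a x))). Qed.

Lemma pintZ (k : R) w f : 0 <= k -> (forall x, 0 <= w x) ->
  measurable_fun [set: n.-tuple R] w -> scalar_measurable f ->
  (k%:E * pint p w f = pint p (fun x => (k * w x)%R) f)%E.
Proof.
move=> k0 w0 mw mf; rewrite /pint -ge0_integralZl_EFin.
- by apply: eq_integral => x _; rewrite -EFinM mulrCA.
- exact: measurableT.
- by move=> x _; rewrite lee_fin mulr_ge0// powR_ge0.
- by apply/measurable_EFinP; exact: measurable_pint.
- exact: k0.
Qed.

Lemma pintD w w' f g : (forall x, 0 <= w x) -> (forall x, 0 <= w' x) ->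
  measurable_fun [set: n.-tuple R] w -> measurable_fun [set: n.-tuple R] w' ->
  scalar_measurable f -> scalar_measurable g ->
  (pint p w f + pint p w' g = \int[mu]_x
    (modulus (f x) `^ p * w x + modulus (g x) `^ p * w' x)%:E)%E.
Proof.
move=> w0 w'0 mw mw' mf mg; rewrite /pint -ge0_integralD.
- by apply: eq_integral => x _; rewrite -EFinD.
- exact: measurableT.
- by move=> x _; rewrite lee_fin mulr_ge0// powR_ge0.
- by apply/measurable_EFinP; exact: measurable_pint.
- by move=> x _; rewrite lee_fin mulr_ge0// powR_ge0.
- by apply/measurable_EFinP; exact: measurable_pint.
Qed.

Lemma eq_pintD w w' w'' f g h : (forall x, 0 <= w x) -> (forall x, 0 <= w' x) ->
  measurable_fun [set: n.-tuple R] w -> measurable_fun [set: n.-tuple R] w' ->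
  scalar_measurable f -> scalar_measurable g ->
  (forall x, modulus (f x) `^ p * w x + modulus (g x) `^ p * w' x =
    modulus (h x) `^ p * w'' x) ->
  (pint p w f + pint p w' g = pint p w'' h)%E.
Proof.
by move=> w0 w'0 mw mw' mf mg E; rewrite pintD//; apply: eq_integral => x _; rewrite E.
Qed.

Lemma le_pint w w' f : (forall x, 0 <= w x) -> (forall x, w x <= w' x) ->
  measurable_fun [set: n.-tuple R] w -> measurable_fun [set: n.-tuple R] w' ->
  scalar_measurable f -> (pint p w f <= pint p w' f)%E.
Proof.
move=> w0 ww' mw mw' mf; apply: ge0_le_integral.
- exact: measurableT.
- by move=> x _; rewrite lee_fin mulr_ge0// powR_ge0.
- by apply/measurable_EFinP; exact: measurable_pint.
- by apply/measurable_EFinP; exact: measurable_pint.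
- by move=> x _; rewrite lee_fin ler_wpM2l// powR_ge0.
Qed.

Lemma ae_le_pintD w w0 w1 g f0 f1 : (forall x, 0 <= w x) ->
  (forall x, 0 <= w0 x) -> (forall x, 0 <= w1 x) ->
  measurable_fun [set: n.-tuple R] w -> measurable_fun [set: n.-tuple R] w0 ->
  measurable_fun [set: n.-tuple R] w1 -> scalar_measurable g ->
  scalar_measurable f0 -> scalar_measurable f1 ->
  {ae mu, forall x, modulus (g x) `^ p * w x <=
    modulus (f0 x) `^ p * w0 x + modulus (f1 x) `^ p * w1 x} ->
  (pint p w g <= pint p w0 f0 + pint p w1 f1)%E.
Proof.
move=> wp w0p w1p mw mw0 mw1 mg mf0 mf1 H; rewrite pintD//.
apply: ae_ge0_le_integral.
- exact: measurableT.
- by move=> x _; rewrite lee_fin mulr_ge0// powR_ge0.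
- by apply/measurable_EFinP; exact: measurable_pint.
- by move=> x _; rewrite lee_fin addr_ge0// mulr_ge0// powR_ge0.
- by apply/measurable_EFinP; apply: measurable_funD; exact: measurable_pint.
by apply: (ae_imply H) => x Hx _; rewrite lee_fin.
Qed.

Lemma sublinear_split T f th :
  sublinear_operator T ->
  op_dom T (fun x => embed (th x) * f x) ->
  op_dom T (fun x => embed (1 - th x) * f x) ->
  {ae mu, forall x, modulus (T f x) <= modulus (T (fun x => embed (th x) * f x) x) +
    modulus (T (fun x => embed (1 - th x) * f x) x)}.
Proof.
move=> [_ sT _] d0 d1; have := sT _ _ d0 d1.
rewrite (_ : (fun y => _ + _) = f)//.
by apply/funext => x; rewrite -mulrDl -embedD subrKC embed1 mul1r.
Qed.

Local Opaque pint.

Lemma pint_shift b u f : measurable_fun [set: n.-tuple R] b ->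
  scalar_measurable f ->
  pint p (fun x => expR (b x + u)) f =
  ((expR u)%:E * pint p (fun x => expR (b x)) f)%E.
Proof.
move=> mb mf; rewrite pintZ//; last exact: measurableT_comp.
by congr pint; apply/funext => x; rewrite expRD mulrC.
Qed.

Lemma Lp_space_shift b u : measurable_fun [set: n.-tuple R] b ->
  @Lp_space R s n p (fun x => expR (b x + u)) = Lp_space p (fun x => expR (b x)).
Proof.
move=> mb; apply/seteqP; split => f Lf; have [mf fy] := (Lp_space_expP _ f).1 Lf;
  apply/(Lp_space_expP _ f); (split; first exact: mf).
- have -> : (fun x => expR (b x)) = (fun x => expR ((b x + u) - u)).
    by apply/funext => x; rewrite addrK.
  rewrite pint_shift//; last exact: measurable_funD.
  by rewrite lte_mul_pinfty// lee_fin expR_ge0.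
- by rewrite (pint_shift u mb mf) lte_mul_pinfty// lee_fin expR_ge0.
Qed.

Lemma bounded_on_shift T b (u M : R) : measurable_fun [set: n.-tuple R] b ->
  bounded_on T (fun x => expR (b x)) M -> bounded_on T (fun x => expR (b x + u)) M.
Proof.
move=> mb [dom mT bd]; split; rewrite (Lp_space_shift u mb); [exact: dom|exact: mT|].
move=> f Lf.
have mf := Lf.1; have mTf := mT _ Lf.
rewrite (pint_shift u mb mTf) (pint_shift u mb mf) muleCA; apply: lee_wpmul2l; last exact: bd.
by rewrite lee_fin expR_ge0.
Qed.

(** Split [f] optimally for the endpoint weights multiplied by the [p]-th powers of the operator
    bounds. Then [psum_split] turns the total cost into the right side without loss, while [psum_le]
    bounds the left side from [|T f| <= |T f0| + |T f1|]. *)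
Lemma sublinear_psum_le T a b (L0 L1 t : R) f :
  measurable_fun [set: n.-tuple R] a -> measurable_fun [set: n.-tuple R] b ->
  0 < t -> t < 1 -> sublinear_operator T ->
  bounded_on T (fun x => expR (a x)) (expR L0) ->
  bounded_on T (fun x => expR (b x)) (expR L1) ->
  scalar_measurable (T f) ->
  Lp_space p (fun x => expR ((1 - t) * a x + t * b x)) f ->
  (pint p (fun x => psum p (a x) (b x)) (T f) <=
   pint p (fun x => psum p (a x + p * L0) (b x + p * L1)) f)%E.
Proof.
move=> ma mb t0 t1 sT [dom0 mT0 bd0] [dom1 mT1 bd1] mTf.
move=> /Lp_space_expP [mf fy].
pose al (x : n.-tuple R) := a x + p * L0; pose be (x : n.-tuple R) := b x + p * L1.
have mal : measurable_fun [set: n.-tuple R] al by apply: measurable_funD.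
have mbe : measurable_fun [set: n.-tuple R] be by apply: measurable_funD.
pose th (x : n.-tuple R) := psplit p (al x) (be x).
have th0 x : 0 <= th x by exact: psplit_ge0.
have th1 x : 0 <= 1 - th x by rewrite -psplitC psplit_ge0.
have mS : measurable_fun [set: n.-tuple R]
    (fun x => expR (- ((p - 1)^-1 * al x)) + expR (- ((p - 1)^-1 * be x))).
  by apply: measurable_funD; apply: measurableT_comp => //;
    apply: measurableT_comp => //; apply: measurable_funM.
have mth : measurable_fun [set: n.-tuple R] th.
  have -> : th = (fun x => expR (- ((p - 1)^-1 * al x)) *
     (expR (- ((p - 1)^-1 * al x)) + expR (- ((p - 1)^-1 * be x))) `^ (-1)).
    by apply/funext => x; rewrite powR_inv1// addr_ge0// expR_ge0.
  apply: measurable_funM; last exact: (measurableT_comp (measurable_powR _)).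
  by apply: measurableT_comp => //; apply: measurableT_comp => //; apply: measurable_funM.
have mth1 : measurable_fun [set: n.-tuple R] (fun x => 1 - th x) by apply: measurable_funB.
pose f0 : fct := fun x => embed (th x) * f x.
pose f1 : fct := fun x => embed (1 - th x) * f x.
have mf0 : scalar_measurable f0 by exact: scalar_measurable_embedM.
have mf1 : scalar_measurable f1 by exact: scalar_measurable_embedM.
have mea : measurable_fun [set: n.-tuple R] (fun x => expR (a x)) by exact: measurableT_comp.
have meb : measurable_fun [set: n.-tuple R] (fun x => expR (b x)) by exact: measurableT_comp.
have mps : measurable_fun [set: n.-tuple R] (fun x => psum p (al x) (be x)).
  exact: measurable_psum.
have Ipos f' a' : (0 <= pint p (fun x => expR (a' x)) f')%E.
  by apply: pint_ge0 => x; exact: expR_ge0.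
have powE (L : R) : expR L `^ p = expR (p * L) by rewrite -expRM mulrC.
have kp (L : R) : 0 < expR L `^ p by rewrite powR_gt0// expR_gt0.
have EQ : (((expR L0) `^ p)%:E * pint p (fun x => expR (a x)) f0 +
    ((expR L1) `^ p)%:E * pint p (fun x => expR (b x)) f1 =
    pint p (fun x => psum p (al x) (be x)) f)%E.
  rewrite (pintZ (ltW (kp L0)) (fun x => expR_ge0 (a x)) mea mf0).
  rewrite (pintZ (ltW (kp L1)) (fun x => expR_ge0 (b x)) meb mf1).
  have w0 (L : R) c (x : n.-tuple R) : 0 <= expR L `^ p * expR (c x).
    by rewrite mulr_ge0 ?powR_ge0 ?expR_ge0.
  have mw0 (L : R) c : measurable_fun [set: n.-tuple R] (fun x : n.-tuple R => expR (c x)) ->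
      measurable_fun [set: n.-tuple R] (fun x => expR L `^ p * expR (c x)).
    by move=> mc; apply: measurable_funM.
  apply: (eq_pintD (w0 L0 a) (w0 L1 b) (mw0 _ _ mea) (mw0 _ _ meb) mf0 mf1) => x.
  have -> : psum p (al x) (be x) =
      th x `^ p * expR (al x) + (1 - th x) `^ p * expR (be x) by rewrite psum_split.
  rewrite /f0 /f1 !modulusM !modulus_embed !ger0_norm// !powRM ?modulus_ge0//.
  move: (th x) => y; rewrite /al /be !expRD !powE.
  by move: (modulus (f x) `^ p) => z; ring.
have mw : measurable_fun [set: n.-tuple R] (fun x => expR ((1 - t) * a x + t * b x)).
  by apply: measurableT_comp => //; apply: measurable_funD; apply: measurable_funM.
(* Finiteness comes from the intermediate norm of [f] through [psum_le_mix]; it puts both pieces in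
   their endpoint spaces, where [T] is defined and bounded. *)
have fin : (pint p (fun x => psum p (al x) (be x)) f < +oo)%E.
  apply: (@le_lt_trans _ _ ((expR ((1 - t) * (p * L0) + t * (p * L1)))%:E *
     pint p (fun x => expR ((1 - t) * a x + t * b x)) f)%E); last first.
    by rewrite lte_mul_pinfty// ?lee_fin ?expR_ge0.
  rewrite (pintZ (expR_ge0 _) (fun x => expR_ge0 _) mw mf).
  apply: le_pint => //.
  - by move=> x; rewrite ltW// psum_gt0.
  - move=> x; rewrite -expRD (le_trans (psum_le_mix _ _ (ltW t0) (ltW t1)))// ler_expR.
    by rewrite /al /be; lra.
  - exact: measurable_funM.
have cancel_lty (x y : \bar R) (k l : R) : (0 <= x)%E -> (0 <= y)%E ->
    0 < k -> 0 <= l -> (k%:E * x + l%:E * y < +oo)%E -> (x < +oo)%E.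
  move=> x0 y0 k0 l0; rewrite !ltNge; apply: contra; rewrite !leye_eq => /eqP ->.
  rewrite gt0_muley ?lte_fin// addye//.
  by rewrite gt_eqF// (@lt_le_trans _ _ 0%E) ?ltNy0// mule_ge0 ?lee_fin.
rewrite -EQ in fin.
have L0f : Lp_space p (fun x => expR (a x)) f0.
  apply/Lp_space_expP; split; first exact: mf0.
  exact: (cancel_lty _ _ _ _ (Ipos _ _) (Ipos _ _) (kp L0) (ltW (kp L1)) fin).
have L1f : Lp_space p (fun x => expR (b x)) f1.
  apply/Lp_space_expP; split; first exact: mf1.
  rewrite addeC in fin.
  exact: (cancel_lty _ _ _ _ (Ipos _ _) (Ipos _ _) (kp L1) (ltW (kp L0)) fin).
apply: (@le_trans _ _ (pint p (fun x => expR (a x)) (T f0) +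
    pint p (fun x => expR (b x)) (T f1))%E); last first.
  rewrite -[leRHS]EQ; exact: (leeD (bd0 _ L0f) (bd1 _ L1f)).
have mab : measurable_fun [set: n.-tuple R] (fun x => psum p (a x) (b x)).
  exact: measurable_psum.
apply: (ae_le_pintD (fun x => ltW (psum_gt0 _ _ _)) (fun x => expR_ge0 _)
  (fun x => expR_ge0 _) mab mea meb mTf (mT0 _ L0f) (mT1 _ L1f)).
apply: (ae_imply (sublinear_split sT (dom0 _ L0f) (dom1 _ L1f))) => x Hx.
exact: psum_le (modulus_ge0 _) (modulus_ge0 _) (modulus_ge0 _) Hx.
Qed.

Local Transparent pint.

Theorem stein_weiss T a b (L0 L1 t : R) f :
  measurable_fun [set: n.-tuple R] a -> measurable_fun [set: n.-tuple R] b ->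
  0 < t -> t < 1 -> sublinear_operator T ->
  bounded_on T (fun x => expR (a x)) (expR L0) ->
  bounded_on T (fun x => expR (b x)) (expR L1) ->
  scalar_measurable (T f) ->
  Lp_space p (fun x => expR ((1 - t) * a x + t * b x)) f ->
  (pint p (fun x => expR ((1 - t) * a x + t * b x)) (T f) <=
   (expR ((1 - t) * L0 + t * L1) `^ p)%:E *
     pint p (fun x => expR ((1 - t) * a x + t * b x)) f)%E.
Proof.
move=> ma mb t0 t1 sT b0 b1 mTf Lf.
have [mf fy] := Lf.
have C0 := pconst_gt0 p t; have Cy := pconst_lty p1 t0 t1.
have Cfin : pconst p t \is a fin_num by rewrite ge0_fin_numE// ltW.
(* Both sides become integrals over [u] carrying the same positive finite factor [pconst p t]. They
   are compared for each [u], with the second weight multiplied by [expR u], which leaves its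
   operator bound unchanged. *)
rewrite -(@lee_pmul2l _ (pconst p t))//.
set w := fun x => expR (_ + _).
have h0 (g : fct) x : 0 <= modulus (g x) `^ p by exact: powR_ge0.
have mh (g : fct) : scalar_measurable g ->
    measurable_fun [set: n.-tuple R] (fun x => modulus (g x) `^ p).
  by move=> mg; apply: (measurableT_comp (measurable_powR p)); exact: measurable_modulus.
rewrite /pint -(integral_psum_mix p1 t (mh _ mTf) ma mb (h0 _)).
have -> : ((expR ((1 - t) * L0 + t * L1) `^ p)%:E *
    \int[mu]_x (modulus (f x) `^ p * w x)%:E =
    \int[mu]_x (modulus (f x) `^ p *
      expR ((1 - t) * (a x + p * L0) + t * (b x + p * L1)))%:E)%E.
  have mw : measurable_fun [set: n.-tuple R] w.
    by apply: measurableT_comp => //; apply: measurable_funD; apply: measurable_funM.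
  rewrite -/(pint p w f) (pintZ (powR_ge0 _ _) (fun x => expR_ge0 _) mw mf).
  apply: eq_integral => x _; rewrite -expRM -expRD.
  by move: (modulus (f x) `^ p) => z; congr (_ * expR _)%:E; ring.
have maL : measurable_fun [set: n.-tuple R] (fun x => a x + p * L0) by apply: measurable_funD.
have mbL : measurable_fun [set: n.-tuple R] (fun x => b x + p * L1) by apply: measurable_funD.
rewrite -(integral_psum_mix p1 t (mh _ mf) maL mbL (h0 _)).
rewrite /pconst.
have mpos (g : fct) (a' b' : n.-tuple R -> R) u : (0 <= (expR (- (t * u)))%:E *
    \int[mu]_x (modulus (g x) `^ p * psum p (a' x) (b' x + u))%:E)%E.
  rewrite mule_ge0 ?lee_fin ?expR_ge0//; apply: integral_ge0 => x _.
  by rewrite lee_fin mulr_ge0 ?powR_ge0 ?expR_ge0.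
apply: ge0_le_integral.
- exact: measurableT.
- by move=> u _; exact: mpos.
- exact: (measurable_integral_psum p t (mh _ mTf) ma mb (h0 _)).
- exact: (measurable_integral_psum p t (mh _ mf) maL mbL (h0 _)).
move=> u _; apply: lee_wpmul2l; first by rewrite lee_fin; exact: expR_ge0.
have mbu : measurable_fun [set: n.-tuple R] (fun x => b x + u) by apply: measurable_funD.
have mw : measurable_fun [set: n.-tuple R] (fun x => (1 - t) * a x + t * b x).
  by apply: measurable_funD; apply: measurable_funM.
have Lf' : Lp_space p (fun x => expR ((1 - t) * a x + t * (b x + u))) f.
  rewrite (_ : (fun x => _) = (fun x => expR ((1 - t) * a x + t * b x + t * u))).
    by rewrite Lp_space_shift.
  by apply/funext => x; rewrite mulrDr addrA.
have E : (fun x => psum p (a x + p * L0) (b x + u + p * L1)) =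
    (fun x => psum p (a x + p * L0) (b x + p * L1 + u)).
  by apply/funext => x; rewrite addrAC.
have := sublinear_psum_le ma mbu t0 t1 sT b0 (bounded_on_shift u mb b1) mTf Lf'.
by rewrite E => H; exact: H.
Qed.

End SteinWeiss.

(** * Half-open cubes *)

Section HalfOpenCubes.
Context {R : realType} {n : nat}.
Local Notation mu := (@lebesgue_measure_tuple R n).
Local Notation T := (n.-tuple R).
Implicit Types f g : T -> R.

(* A node [(a, h)] of the dyadic tree stands for the half-open cube with corner
   [a] and side [h]; half-open cubes are partitioned by their dyadic children. *)
Definition node : Type := (T * {posnum R})%type.

Definition hcube (P : node) : set T :=
  [set x | forall i, tnth P.1 i <= tnth x i < tnth P.1 i + P.2%:num].

Definition vol (P : node) : R := P.2%:num ^+ n.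

Definition child (e : {ffun 'I_n -> bool}) (P : node) : node :=
  ([tuple tnth P.1 i + (e i)%:R * (P.2%:num / 2) | i < n], (P.2%:num / 2)%:pos).

Lemma vol_gt0 P : 0 < vol P. Proof. exact: exprn_gt0. Qed.

Lemma vol_child e P : vol P = 2 ^+ n * vol (child e P).
Proof. by rewrite /vol /= -exprMn mulrCA divff ?mulr1. Qed.

Lemma measurable_hcube P : measurable (hcube P).
Proof.
have -> : hcube P = \bigcap_(i in [set: 'I_n]) ((fun x : T => tnth x i) @^-1`
    `[tnth P.1 i, tnth P.1 i + P.2%:num[%classic).
  apply/seteqP; split=> x /=; first by move=> H i _ /=; rewrite in_itv/=; exact: H.
  by move=> H i; have := H i I; rewrite /= in_itv/=.
apply: fin_bigcap_measurable => // i _.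
by rewrite -[X in measurable X]setTI; apply: measurable_tnth.
Qed.

Lemma bernoulli_ge (k : nat) (e : R) : 0 <= e -> e <= 1 -> 1 - e *+ k <= (1 - e) ^+ k.
Proof.
move=> e0 e1; elim: k => [|k IH]; first by rewrite mulr0n subr0 expr0.
rewrite exprS; have := ler_wpM2l (_ : 0 <= 1 - e) IH.
rewrite subr_ge0 => /(_ e1); apply: le_trans.
rewrite mulrS -mulr_natr; have : 0 <= k%:R :> R by [].
nra.
Qed.

(** The half-open cube lies between closed cubes of sides [h * (1 - e)] and [h]; Bernoulli's
    inequality bounds the loss of volume. *)
Lemma mu_hcube P : mu (hcube P) = (vol P)%:E.
Proof.
case: P => a h; apply/le_anti/andP; split.
  have [mC <-] := @lebesgue_measure_cube R n a h%:num (ltW [gt0 of h%:num]).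
  apply: le_measure; rewrite ?inE//; first exact: measurable_hcube.
  by move=> x H i; have /andP[-> /ltW ->] := H i.
have lo (e : R) : 0 < e -> e < 1 -> ((vol (a, h) * (1 - e *+ n))%:E <= mu (hcube (a, h)))%E.
  move=> e0 e1.
  have h0 : 0 < h%:num * (1 - e) by rewrite mulr_gt0// subr_gt0.
  have [mC muC] := @lebesgue_measure_cube R n a (h%:num * (1 - e)) (ltW h0).
  apply: (@le_trans _ _ (mu (cube a (h%:num * (1 - e))))).
    by rewrite muC lee_fin exprMn ler_wpM2l ?exprn_ge0// bernoulli_ge// ltW.
  apply: le_measure; rewrite ?inE//; first exact: measurable_hcube.
  move=> x H i; have /andP[-> H2] := H i; rewrite /= (le_lt_trans H2)//.
  by rewrite ltrD2l gtr_pMr// ltrBlDr ltrDl.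
apply/lee_addgt0Pr => d d0.
pose v := vol (a, h); have v0 : 0 < v := vol_gt0 _.
(* The second term keeps the loss [v * (e *+ n)] below [d]; [n.+1] avoids a zero denominator in
   dimension 0. *)
pose e := Num.min (2^-1) (d / (v * n.+1%:R)).
have e0 : 0 < e by rewrite lt_min invr_gt0 ltr0n divr_gt0// mulr_gt0.
have e1 : e < 1 by rewrite gt_min invf_lt1 ?ltr1n.
have := lo e e0 e1; rewrite -(@leeD2rE _ d%:E)//; apply: le_trans.
rewrite -EFinD lee_fin -/v mulrBr mulr1 -addrA lerDl addrC subr_ge0.
have : e <= d / (v * n.+1%:R) by rewrite ge_min lexx orbT.
rewrite ler_pdivlMr ?mulr_gt0//; apply: le_trans.
have -> : v * (e *+ n) = e * (v * n%:R) by rewrite -[e *+ n]mulr_natr mulrCA.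
by rewrite ler_wpM2l ?(ltW e0)// ler_wpM2l ?(ltW v0)// ler_nat.
Qed.

Lemma hcube_child e P x : hcube (child e P) x <->
  hcube P x /\ e = [ffun i => tnth P.1 i + P.2%:num / 2 <= tnth x i].
Proof.
case: P => a h; rewrite /hcube /child /=.
set h' := h%:num; have h0 : 0 < h' := [gt0 of h%:num].
split.
- move=> H; split=> [i|].
    have := H i; rewrite tnth_mktuple; case: (e i) => /= /andP[H1 H2];
      by apply/andP; split; lra.
  apply/ffunP => i; rewrite ffunE; have := H i; rewrite tnth_mktuple.
  case: (e i) => /= /andP[H1 H2]; apply/esym; first by apply/idP; lra.
  by apply/negbTE; rewrite -ltNge; lra.
- move=> [H ->] i; rewrite tnth_mktuple ffunE; have /andP[H2 H3] := H i.
  have [H1|H1] := leP (tnth a i + h' / 2) (tnth x i).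
    by rewrite mul1r; apply/andP; split; lra.
  by rewrite mul0r addr0; apply/andP; split; lra.
Qed.

Lemma hcube_bigsetU P :
  hcube P = \big[setU/set0]_(e <- index_enum {ffun 'I_n -> bool}) hcube (child e P).
Proof.
apply/seteqP; split=> x.
  move=> Px; rewrite -bigcup_seq.
  exists [ffun i => tnth P.1 i + P.2%:num / 2 <= tnth x i].
    by rewrite /= mem_index_enum.
  exact/hcube_child.
by rewrite -bigcup_seq => -[e _ /hcube_child[]].
Qed.

Lemma trivIset_child P (D : set {ffun 'I_n -> bool}) :
  trivIset D (fun e => hcube (child e P)).
Proof.
apply/trivIsetP => e e' _ _ ee'; rewrite -subset0 => x [] /hcube_child[_ E] /hcube_child[_ E'].
by move: ee'; rewrite E -E' eqxx.
Qed.

Definition locint (f : T -> R) : Prop :=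
  measurable_fun [set: T] f /\ forall P, mu.-integrable (hcube P) (EFin \o f).

Definition cint (f : T -> R) (P : node) : R := (\int[mu]_(x in hcube P) f x)%R.

Lemma locint_EFin f P : locint f ->
  (\int[mu]_(x in hcube P) (f x)%:E = (cint f P)%:E)%E.
Proof.
move=> [mf /(_ P) If]; rewrite /cint /Rintegral fineK//.
exact: (integrable_fin_num (measurable_hcube P) If).
Qed.

Lemma locintD f g : locint f -> locint g -> locint (fun x => f x + g x).
Proof.
move=> [mf If] [mg Ig]; split; first exact: measurable_funD.
move=> P; have := integrableD (measurable_hcube P) (If P) (Ig P).
by apply: eq_integrable => //; exact: measurable_hcube.
Qed.

Lemma locintZ k f : locint f -> locint (fun x => k * f x).
Proof.
move=> [mf If]; split; first exact: measurable_funM.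
move=> P; have := integrableZl (measurable_hcube P) k (If P).
by apply: eq_integrable => //; exact: measurable_hcube.
Qed.

Lemma locint_dom f g : measurable_fun [set: T] f -> locint g ->
  (forall x, `|f x| <= `|g x|) -> locint f.
Proof.
move=> mf [mg Ig] fg; split=> // P.
apply: (le_integrable (measurable_hcube P)) (Ig P).
  by apply/measurable_EFinP; exact: measurable_funS mf.
by move=> x _ /=; rewrite lee_fin.
Qed.

Lemma locint_cst (k : R) : locint (fun=> k).
Proof.
split=> // P; apply/integrableP; split; first exact/measurable_EFinP.
rewrite integral_cst; last exact: measurable_hcube.
by rewrite /= mu_hcube -EFinM ltry.
Qed.

Lemma locint_bounded f (M : R) : measurable_fun [set: T] f ->
  (forall x, `|f x| <= M) -> locint f.
Proof.
move=> mf fM; apply: (locint_dom mf (locint_cst M)) => x.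
exact: le_trans (fM x) (ler_norm _).
Qed.

Lemma locint_abs f : locint f -> locint (fun x => `|f x|).
Proof.
move=> If; apply: (locint_dom _ If) => [|x]; last by rewrite normr_id.
by apply: measurableT_comp => //; exact: If.1.
Qed.

Lemma locintN f : locint f -> locint (fun x => - f x).
Proof.
move=> /(locintZ (-1)); rewrite (_ : (fun x => -1 * f x) = (fun x => - f x))//.
by apply/funext => x; rewrite mulN1r.
Qed.

Lemma locintB f g : locint f -> locint g -> locint (fun x => f x - g x).
Proof. by move=> If /locintN; exact: locintD. Qed.

Lemma locint_subcst f (c : R) : locint f -> locint (fun x => `|f x - c|).
Proof. by move=> If; apply/locint_abs/locintB => //; exact: locint_cst. Qed.

Lemma cintD f g P : locint f -> locint g ->
  cint (fun x => f x + g x) P = cint f P + cint g P.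
Proof. by move=> [_ If] [_ Ig]; apply: RintegralD => //; exact: measurable_hcube. Qed.

Lemma cintZ k f P : locint f -> cint (fun x => k * f x) P = k * cint f P.
Proof. by move=> [_ If]; apply: RintegralZl => //; exact: measurable_hcube. Qed.

Lemma cintB f g P : locint f -> locint g ->
  cint (fun x => f x - g x) P = cint f P - cint g P.
Proof. by move=> [_ If] [_ Ig]; apply: RintegralB => //; exact: measurable_hcube. Qed.

Lemma cint_cst (k : R) P : cint (fun=> k) P = k * vol P.
Proof. rewrite /cint Rintegral_cst; last exact: measurable_hcube.
by rewrite /= mu_hcube. Qed.

Lemma le_cint f g P : locint f -> locint g -> (forall x, f x <= g x) ->
  cint f P <= cint g P.
Proof.
by move=> [_ If] [_ Ig] fg; apply: le_Rintegral => //; exact: measurable_hcube.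
Qed.

Lemma cint_ge0 f P : (forall x, 0 <= f x) -> 0 <= cint f P.
Proof. by move=> f0; apply: Rintegral_ge0. Qed.

Lemma norm_cint f P : locint f -> `|cint f P| <= cint (fun x => `|f x|) P.
Proof. by move=> [_ If]; apply: le_normr_Rintegral => //; exact: measurable_hcube. Qed.

Lemma cint_additive f : locint f -> tree_additive child (cint f).
Proof.
move=> If P; apply: EFin_inj; rewrite -locint_EFin// -sumEFin.
under eq_bigr do rewrite -locint_EFin//.
rewrite [in LHS]hcube_bigsetU integral_bigsetU_EFin//.
- by move=> e; exact: measurable_hcube.
- exact: index_enum_uniq.
- exact: trivIset_child.
- by apply/measurable_EFinP; apply: measurable_funS If.1.
Qed.

Lemma vol_additive : tree_additive child vol.
Proof.
move=> P; have := cint_additive (locint_cst 1) P.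
by rewrite cint_cst mul1r => ->; apply: eq_bigr => e _; rewrite cint_cst mul1r.
Qed.

Definition cavg (f : T -> R) P : R := cint f P / vol P.

Lemma cavg_sub f P (c : R) : locint f ->
  `|cavg f P - c| * vol P <= cint (fun x => `|f x - c|) P.
Proof.
move=> If; have v0 := vol_gt0 P.
apply: le_trans (norm_cint _ (locintB If (locint_cst c))).
rewrite cintB//; last exact: locint_cst.
by rewrite cint_cst -{1}(gtr0_norm v0) -normrM mulrBl divfK// gt_eqF.
Qed.

Lemma cint_osc_le f P (c : R) : locint f ->
  cint (fun x => `|f x - cavg f P|) P <= 2 * cint (fun x => `|f x - c|) P.
Proof.
move=> If.
apply: (@le_trans _ _ (cint (fun x => `|f x - c| + `|cavg f P - c|) P)).
  apply: le_cint; [exact: locint_subcst| |].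
    by apply: locintD; [exact: locint_subcst|exact: locint_cst].
  by move=> x; rewrite (distrC (cavg f P) c) ler_distD.
rewrite cintD; [|exact: locint_subcst|exact: locint_cst].
by rewrite cint_cst mulr_natl mulr2n lerD2l cavg_sub.
Qed.

End HalfOpenCubes.

(** * Density of dyadic step functions *)

Section DyadicDensity.
Context {R : realType} {n : nat}.
Local Notation mu := (@lebesgue_measure_tuple R n).
Local Notation T := (n.-tuple R).
Implicit Types (f g : T -> R) (A B : set T).
Local Notation leaves := (leaf_sum (@child R n)).
Local Notation node := (@node R n).

Lemma leaf_sum_transfer k P f f' (c : node -> R) : locint f -> locint f' ->
  leaves k (fun D => cint (fun x => `|f x - c D|) D) P <=
  cint (fun x => `|f x - f' x|) P +
  leaves k (fun D => cint (fun x => `|f' x - c D|) D) P.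
Proof.
move=> If If'; have Id := locint_abs (locintB If If').
rewrite -(leaf_sum_additive k P (cint_additive Id)) -leaf_sumD.
apply: le_leaf_sum => D.
rewrite -cintD//; last exact: locint_subcst.
apply: le_cint; [exact: locint_subcst| |by move=> x; exact: ler_distD].
by apply: locintD => //; exact: locint_subcst.
Qed.

(** Values 0 and 1 on the leaves make Boolean operations available; asking for all large depths lets
    two approximations share a depth. *)
Definition set_approx (P : node) A := measurable A /\
  forall eta, 0 < eta -> exists k0, forall k, (k0 <= k)%N -> exists c : node -> bool,
  leaves k (fun D => cint (fun x => `|\1_A x - (c D)%:R|) D) P <= eta.

Lemma indic01 A x : (\1_A x : R) = (x \in A)%:R.
Proof. by rewrite indicE. Qed.

Lemma locint_indic A : measurable A -> locint (\1_A : T -> R).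
Proof.
move=> mA; apply: (@locint_bounded _ _ _ 1) => [|x]; first exact: measurable_indic.
by rewrite indic01; case: (_ \in _); rewrite ?normr1 ?normr0.
Qed.

Lemma set_approx0 P : set_approx P set0.
Proof.
split => // eta eta0; exists 0%N => k _; exists (fun=> false).
apply: (@le_trans _ _ (leaves k (fun D => 0 * vol D) P)).
  apply: le_leaf_sum => D; rewrite -cint_cst; apply: le_cint.
  - exact/locint_subcst/locint_indic.
  - exact: locint_cst.
  - by move=> x; rewrite indic0 subr0 normr0.
by rewrite leaf_sumZ mul0r ltW.
Qed.

Lemma set_approxC P A : set_approx P A -> set_approx P (~` A).
Proof.
move=> [mA H]; split; first exact: measurableC.
move=> eta /H[k0 H']; exists k0 => k /H'[c Hc]; exists (fun D => ~~ c D).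
apply: le_trans Hc; apply: le_leaf_sum => D; apply: le_cint.
- exact/locint_subcst/locint_indic/measurableC.
- exact/locint_subcst/locint_indic.
move=> x; rewrite !indic01 in_setC.
by case: (x \in A); case: (c D) => /=; rewrite ?subr0 ?sub0r ?subrr ?normrN.
Qed.

Lemma set_approxI P A B : set_approx P A -> set_approx P B -> set_approx P (A `&` B).
Proof.
move=> [mA HA] [mB HB]; split; first exact: measurableI.
move=> eta eta0; have e20 : 0 < eta / 2 by rewrite divr_gt0.
have [kA {}HA] := HA _ e20; have [kB {}HB] := HB _ e20.
exists (maxn kA kB) => k; rewrite geq_max => /andP[/HA[c Hc] /HB[d Hd]].
exists (fun D => c D && d D); rewrite (splitr eta).
apply: le_trans (lerD Hc Hd); rewrite -leaf_sumD; apply: le_leaf_sum => D.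
rewrite -cintD; [|exact/locint_subcst/locint_indic..].
apply: le_cint.
- exact/locint_subcst/locint_indic/measurableI.
- by apply: locintD; exact/locint_subcst/locint_indic.
move=> x; rewrite !indic01 in_setI.
case: (x \in A); case: (x \in B); case: (c D); case: (d D) => /=;
  by rewrite ?subr0 ?sub0r ?subrr ?normrN ?normr0 ?normr1; lra.
Qed.

Lemma set_approxU P A B : set_approx P A -> set_approx P B -> set_approx P (A `|` B).
Proof.
by move=> HA HB; rewrite -[A `|` B]setCK setCU; apply/set_approxC/set_approxI;
  exact: set_approxC.
Qed.

Lemma cint_indic A P : measurable A -> (cint (\1_A) P)%:E = mu (hcube P `&` A).
Proof.
move=> mA; rewrite -locint_EFin; last exact: locint_indic.
by rewrite integral_indic//; [rewrite setIC|exact: measurable_hcube].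
Qed.

(** Inside [P], which has finite measure, a finite subunion already fills the union up to [eta / 2]
    by continuity from below. *)
Lemma set_approx_bigcup P (A : (set T)^nat) : (forall k, set_approx P (A k)) ->
  set_approx P (\bigcup_k A k).
Proof.
move=> HA; have mA k := (HA k).1.
have mU : measurable (\bigcup_k A k) by exact: bigcup_measurable.
pose B N := \big[setU/set0]_(i < N.+1) A i.
have HB N : set_approx P (B N).
  rewrite /B; elim: N.+1 => [|k IH]; first by rewrite big_ord0; exact: set_approx0.
  by rewrite big_ord_recr; exact: set_approxU.
have mB N := (HB N).1.
have BU N : B N `<=` \bigcup_k A k.
  by rewrite /B -bigcup_mkord => x [k _ Ax]; exists k.
split=> // eta eta0; have e20 : 0 < eta / 2 by rewrite divr_gt0.
have [N HN] : exists N, cint (fun x => `|\1_(\bigcup_k A k) x - \1_(B N) x|) P <= eta / 2.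
  have mPB N : measurable (hcube P `&` B N).
    by apply: measurableI => //; exact: measurable_hcube.
  have UE : \bigcup_N (hcube P `&` B N) = hcube P `&` \bigcup_k A k.
    by rewrite -setI_bigcupr bigcup_bigsetU_bigcup.
  have cv : mu \o (fun N => hcube P `&` B N) @ \oo --> mu (hcube P `&` \bigcup_k A k).
    rewrite -UE; apply: nondecreasing_cvg_mu => //.
      exact: bigcup_measurable.
    apply/nondecreasing_seqP => N; apply/subsetPset; apply: setIS.
    by rewrite /B [X in _ `<=` X]big_ord_recr; left.
  have lt : ((cint (\1_(\bigcup_k A k)) P - eta / 2)%:E < mu (hcube P `&` \bigcup_k A k))%E.
    by rewrite -cint_indic// lte_fin ltrBlDr ltrDl.
  have := cv _ (open_ereal_gt' lt).
  move=> [N _ /(_ N (leqnn N))] /=; rewrite -cint_indic// lte_fin => H; exists N.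
  have -> : (fun x => `|\1_(\bigcup_k A k) x - \1_(B N) x| : R) =
            (fun x => \1_(\bigcup_k A k) x - \1_(B N) x).
    apply/funext => x; rewrite !indic01 ger0_norm// subr_ge0 ler_nat.
    by case: (boolP (x \in B N)) => // /set_mem/BU/mem_set ->.
  rewrite cintB; [|exact: locint_indic..].
  by rewrite lerBlDr addrC -lerBlDr ltW.
have [k0 Hk0] := (HB N).2 _ e20; exists k0 => k /Hk0[c Hc]; exists c.
rewrite (splitr eta); apply: le_trans (lerD HN Hc).
by apply: leaf_sum_transfer; exact: locint_indic.
Qed.

Section ray.
Variables (i : 'I_n) (x0 : R).

Let straddle (D : node) : bool := tnth D.1 i <= x0 < tnth D.1 i + D.2%:num.

(** Flipping the [i]-th bit exchanges the children on the two sides, and all children have the same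
    volume. *)
Let sumb (P : node) (b : bool) :
  \sum_(e : {ffun 'I_n -> bool}) (if e i == b then vol (child e P) else 0) = vol P / 2.
Proof.
pose S (b' : bool) : R :=
  \sum_(e : {ffun 'I_n -> bool}) (if e i == b' then vol (child e P) else 0).
pose flip (e : {ffun 'I_n -> bool}) := [ffun j => if j == i then ~~ e j else e j].
have flipK : involutive flip.
  by move=> e; apply/ffunP => j; rewrite !ffunE; case: eqP => //; rewrite negbK.
have split_if (x y : bool) (v : R) :
    v = (if x == y then v else 0) + (if x == ~~ y then v else 0).
  by case: x y => -[]; rewrite ?addr0 ?add0r.
have Sum : S b + S (~~ b) = vol P.
  rewrite [RHS]vol_additive -big_split; apply: eq_bigr => e _ /=.
  exact/esym/split_if.
have E : S b = S (~~ b).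
  rewrite /S (reindex_inj (inv_inj flipK)); apply: eq_bigr => e _.
  by rewrite ffunE eqxx eqb_negLR.
rewrite -/(S b); lra.
Qed.

Lemma leaf_sum_straddle k P :
  leaves k (fun D => if straddle D then vol D else 0) P <=
  if straddle P then vol P / 2 ^+ k else 0.
Proof.
elim: k P => [|k IH] P /=; first by case: ifP => //; rewrite expr0 divr1.
case: ifPn => [stP|nstP].
  pose b := tnth P.1 i + P.2%:num / 2 <= x0.
  apply: (@le_trans _ _ (\sum_(e : {ffun 'I_n -> bool})
      (if e i == b then vol (child e P) else 0) / 2 ^+ k)).
    apply: ler_sum => e _; apply: le_trans (IH _) _.
    case: ifPn => st; last first.
      by rewrite divr_ge0 ?exprn_ge0//; case: ifP => // _; exact/ltW/vol_gt0.
    have -> : e i == b; last by [].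
    move: st; rewrite /straddle /b /= tnth_mktuple; case: (e i) => /= /andP[h1 h2];
      apply/eqP/esym; first by apply/idP; lra.
    by apply/negbTE; rewrite -ltNge; lra.
  by rewrite -mulr_suml sumb exprS invfM mulrA.
apply: sumr_le0 => e _; apply: le_trans (IH _) _.
case: ifPn => // st; exfalso; move/negP: nstP; apply; move: st.
rewrite /straddle /= tnth_mktuple; have := [gt0 of P.2%:num].
by case: (e i) => /= h0 /andP[h1 h2]; apply/andP; split; lra.
Qed.

(** The indicator is constant on every leaf not straddling [x0] in direction [i]; each subdivision
    halves the volume of the straddling leaves. *)
Lemma set_approx_ray P : set_approx P [set x | x0 < tnth x i].
Proof.
have mA : measurable [set x : T | x0 < tnth x i].
  rewrite (_ : [set x | _] = (fun x : T => tnth x i) @^-1` `]x0, +oo[%classic).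
    by rewrite -[X in measurable X]setTI; apply: measurable_tnth.
  by apply/seteqP; split=> x /=; rewrite in_itv/= andbT.
split=> // eta eta0.
have [k0 Hk0] : exists k0, forall k, (k0 <= k)%N -> vol P / 2 ^+ k <= eta.
  have v0 := vol_gt0 P.
  exists (Num.bound (vol P / eta)) => k kk.
  rewrite ler_pdivrMr ?exprn_gt0// mulrC -ler_pdivrMr//.
  have := archi_boundP (ltW (divr_gt0 v0 eta0)) => /ltW/le_trans; apply.
  apply: (@le_trans _ _ k%:R); first by rewrite ler_nat.
  by rewrite -natrX ler_nat ltnW// ltn_expl.
exists k0 => k /Hk0 Hk; exists (fun D => x0 < tnth D.1 i).
apply: le_trans (le_trans (leaf_sum_straddle k P) _); last first.
  by case: ifP => // _; exact: ltW.
apply: le_leaf_sum => D; rewrite /cint /Rintegral.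
have -> : (\int[mu]_(x in hcube D) (`|\1_[set x | (x0 < tnth x i)%R] x -
     (x0 < tnth D.1 i)%R%:R|)%:E = \int[mu]_(x in hcube D)
     ((if straddle D then
        `|\1_[set x | (x0 < tnth x i)%R] x - (x0 < tnth D.1 i)%R%:R| else 0)%:E))%E.
  apply: eq_integral => x /set_mem Dx; case: ifPn => // st.
  rewrite indic01 (_ : (x \in _) = (x0 < tnth x i)); last first.
    by apply/idP/idP => [/set_mem|H] //; exact/mem_set.
  have /andP[h1 h2] := Dx i.
  have [h3|h3] := ltP x0 (tnth D.1 i).
    by rewrite (lt_le_trans h3 h1) subrr normr0.
  move: st; rewrite /straddle h3 /= -leNgt => h4.
  by rewrite ltNge (le_trans (ltW h2) h4) subrr normr0.
case: ifPn => st; last by rewrite integral0.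
rewrite -[leRHS]mul1r -cint_cst; apply: le_cint.
- exact/locint_subcst/locint_indic.
- exact: locint_cst.
by move=> x; rewrite indic01; case: (_ \in _); case: (_ < _);
  rewrite ?subrr ?subr0 ?sub0r ?normrN ?normr0 ?normr1.
Qed.

End ray.

(** The approximable sets form a sigma-algebra. Its generators are reduced twice: from measurable
    sets of tuples to preimages under coordinates, and from Borel sets of the line to open right
    rays. *)
Lemma set_approx_measurable P A : measurable A -> set_approx P A.
Proof.
have salg : sigma_algebra setT (set_approx P).
  split; [exact: set_approx0| |exact: set_approx_bigcup].
  by move=> B HB; rewrite setTD; exact: set_approxC.
apply: (smallest_sub salg) => {}A.
rewrite -bigcup_seq => -[i _ [B mB <-]].
have {mB} : (<<s @RGenOInfty.G R >> : set (set R)) B.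
  exact: (eq_ind _ (fun M : set (set R) => M B) mB _ (RGenOInfty.measurableE R)).
rewrite setTI; move: B; apply: smallest_sub.
  split.
  - by rewrite preimage_set0; exact: set_approx0.
  - by move=> B HB; rewrite setTD preimage_setC; exact: set_approxC.
  - by move=> B HB; rewrite preimage_bigcup; exact: set_approx_bigcup.
move=> _ [x ->] /=.
rewrite (_ : _ @^-1` _ = [set y | x < tnth y i]); first exact: set_approx_ray.
by apply/seteqP; split=> y /=; rewrite in_itv/= andbT.
Qed.

Definition step_approx (P : node) f := forall eta, 0 < eta ->
  exists k0, forall k, (k0 <= k)%N -> exists c : node -> R,
  leaves k (fun D => cint (fun x => `|f x - c D|) D) P <= eta.

Lemma step_approx_indic P A : measurable A -> step_approx P (\1_A).
Proof.
move=> /(set_approx_measurable P)[_ H] eta /H[k0 H']; exists k0 => k /H'[c Hc].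
by exists (fun D => (c D)%:R).
Qed.

Lemma step_approxD P f g : locint f -> locint g ->
  step_approx P f -> step_approx P g -> step_approx P (fun x => f x + g x).
Proof.
move=> If Ig Hf Hg eta eta0; have e20 : 0 < eta / 2 by rewrite divr_gt0.
have [kA {}Hf] := Hf _ e20; have [kB {}Hg] := Hg _ e20.
exists (maxn kA kB) => k; rewrite geq_max => /andP[/Hf[c Hc] /Hg[d Hd]].
exists (fun D => c D + d D); rewrite (splitr eta).
apply: le_trans (lerD Hc Hd); rewrite -leaf_sumD; apply: le_leaf_sum => D.
rewrite -cintD; [|exact: locint_subcst..].
apply: le_cint.
- by apply: locint_subcst; exact: locintD.
- by apply: locintD; exact: locint_subcst.
by move=> x; rewrite opprD addrACA ler_normD.
Qed.

Lemma step_approxZ P f r : locint f -> step_approx P f ->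
  step_approx P (fun x => r * f x).
Proof.
move=> If Hf eta eta0.
have r0 : 0 < `|r| + 1 by rewrite ltr_wpDl.
have [k0 H] := Hf _ (divr_gt0 eta0 r0); exists k0 => k /H[c Hc].
exists (fun D => r * c D).
rewrite -(ler_pM2r r0) divfK in Hc; last by rewrite gt_eqF.
apply: le_trans Hc; rewrite mulrC -leaf_sumZ; apply: le_leaf_sum => D.
rewrite -cintZ; last exact: locint_subcst.
apply: le_cint.
- by apply: locint_subcst; exact: locintZ.
- by apply: locintZ; exact: locint_subcst.
by move=> x; rewrite -mulrBr normrM ler_wpM2r// lerDl.
Qed.

Import HBSimple.

Lemma step_approx_locint P f : locint f -> step_approx P f.
Proof.
move=> If eta eta0; have e20 : 0 < eta / 2 by rewrite divr_gt0.
have [s_ [_ _ cv]] := approximation_sfun_integrable (measurable_hcube P) (If.2 P).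
have [N HN] : exists N, (\int[mu]_(z in hcube P) `|(f z)%:E - (s_ N z)%:E| <= (eta / 2)%:E)%E.
  have := cv _ (open_ereal_lt' (_ : (0 < (eta / 2)%:E)%E)).
  by rewrite lte_fin => /(_ e20) -[N _ /(_ N (leqnn N))] /= /ltW; exists N.
pose S := s_ N.
have [m [r SE]] : exists m (r : 'I_m -> R), forall x,
    S x = \sum_(j < m) r j * \1_(S @^-1` [set r j]) x.
  by eexists; eexists => x; exact: fimfunEord.
have mSj j : measurable (S @^-1` [set r j]) by [].
have sum_approx (m' : nat) (F : 'I_m' -> R) (E : 'I_m' -> set T) :
    (forall j, measurable (E j)) ->
    locint (fun x => \sum_(j < m') F j * \1_(E j) x) /\
    step_approx P (fun x => \sum_(j < m') F j * \1_(E j) x).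
  move=> mE; elim: m' F E mE => [|m' IH] F E mE.
    rewrite (_ : (fun x => _) = (fun=> 0)); last by apply/funext => x; rewrite big_ord0.
    split; first exact: locint_cst.
    rewrite (_ : (fun=> 0) = (fun x => 0 * \1_set0 x : R)); last first.
      by apply/funext => x; rewrite mul0r.
    by apply: step_approxZ; [exact: locint_indic|exact: step_approx_indic].
  rewrite (_ : (fun x => _) = (fun x => F ord0 * \1_(E ord0) x +
      \sum_(j < m') F (lift ord0 j) * \1_(E (lift ord0 j)) x)); last first.
    by apply/funext => x; rewrite big_ord_recl.
  have [I1 I2] := IH (F \o lift ord0) (E \o lift ord0) (fun j => mE _).
  have I3 : locint (fun x => F ord0 * \1_(E ord0) x) by apply/locintZ/locint_indic.
  split; first exact: locintD.
  apply: step_approxD => //; apply: step_approxZ; first exact: locint_indic.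
  exact: step_approx_indic.
have [IS aS] : locint S /\ step_approx P S.
  rewrite (_ : (S : T -> R) = (fun x => \sum_(j < m) r j * \1_(S @^-1` [set r j]) x)).
    exact: sum_approx.
  exact/funext.
have [k0 H] := aS _ e20; exists k0 => k /H[c Hc]; exists c.
rewrite (splitr eta); apply: le_trans (leaf_sum_transfer k P c If IS) _.
apply: lerD => //; rewrite -lee_fin -locint_EFin//.
exact/locint_abs/locintB.
Qed.

(** An [L^1] substitute for Lebesgue differentiation. Replacing arbitrary leaf values by averages
    costs a factor 2 ([cint_osc_le]), hence the [eta / 2]. *)
Lemma dyadic_density P f : locint f -> forall eta, 0 < eta ->
  exists k, leaves k (fun D => cint (fun x => `|f x - cavg f D|) D) P <= eta.
Proof.
move=> If eta eta0; have e20 : 0 < eta / 2 by rewrite divr_gt0.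
have [k /(_ k (leqnn k))[c Hc]] := step_approx_locint P If e20; exists k.
rewrite -(@ler_pM2l _ 2) in Hc => //; rewrite mulrCA divff// mulr1 in Hc.
apply: le_trans Hc; rewrite -leaf_sumZ; apply: le_leaf_sum => D.
exact: cint_osc_le.
Qed.

End DyadicDensity.

(** * Weighted John-Nirenberg inequality *)

(** The exponential truncated at height [N] has slope at most [N]. *)
Lemma minr_expR_le (R : realType) (N u v d : R) : 0 < N -> 0 <= d ->
  u <= v + d -> Num.min (expR u) N <= expR v + N * d.
Proof.
move=> N0 d0 uvd; set m := Num.min _ _.
have m0 : 0 < m by rewrite lt_min expR_gt0.
have mN : m <= N by rewrite ge_min lexx orbT.
have lmu : ln m <= u.
  by rewrite -[leRHS]expRK ler_ln ?posrE ?expR_gt0// ge_min lexx.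
have := expR_ge1Dx (v - ln m); rewrite expRB lnK ?posrE//.
rewrite ler_pdivlMr// => H.
have [lv|lv] := leP (ln m) v.
  have : m <= expR v by rewrite -[leLHS]lnK ?posrE// ler_expR.
  by move=> /le_trans; apply; rewrite lerDl mulr_ge0// ltW.
have : m * (ln m - v) <= N * d by apply: ler_pM; lra.
nra.
Qed.

(** One of the two terms is already at least 1, according to the sign of [ln t + y]. *)
Lemma young_expR (R : realType) (b t y : R) : 0 < b -> 0 < t ->
  1 <= t * expR y + t `^ (- b) * expR (- (b * y)).
Proof.
move=> b0 t0; have t1 := powR_ge0 t (- b).
have tE : t = expR (ln t) by rewrite lnK ?posrE.
have [y0|y0] := leP 0 (ln t + y).
  have : 1 <= t * expR y.
    by rewrite [in leRHS]tE -expRD -[leLHS](@expR0 R) ler_expR.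
  have := mulr_ge0 t1 (expR_ge0 (- (b * y))); lra.
have : 1 <= t `^ (- b) * expR (- (b * y)).
  by rewrite [in leRHS]tE -expRM -expRD -[leLHS](@expR0 R) ler_expR; nra.
have := mulr_ge0 (ltW t0) (expR_ge0 y); lra.
Qed.

Section WeightedJohnNirenberg.
Context {R : realType} {n : nat}.
Local Notation mu := (@lebesgue_measure_tuple R n).
Local Notation T := (n.-tuple R).
Local Notation node := (@node R n).
Implicit Types (f g a : T -> R) (P : node).

Lemma cint_gt0 f P : locint f -> (forall x, 0 < f x) -> 0 < cint f P.
Proof.
move=> If f0; rewrite lt_neqAle cint_ge0 ?andbT; last by move=> x; exact: ltW.
apply/eqP => /esym I0.
have mf : measurable_fun (hcube P) (EFin \o f).
  by apply/measurable_EFinP; apply: measurable_funS If.1.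
have : (\int[mu]_(x in hcube P) `|(EFin \o f) x| = 0)%E.
  transitivity (\int[mu]_(x in hcube P) (f x)%:E)%E.
    by apply: eq_integral => x _ /=; rewrite gtr0_norm.
  by rewrite locint_EFin// I0.
move/(ae_eq_integral_abs mu (measurable_hcube P) mf) => -[N [mN N0 sub]].
have PN : hcube P `<=` N.
  apply: subset_trans sub => x Px /= /(_ Px)/eqP.
  by rewrite eqe gt_eqF.
have : (mu (hcube P) <= mu N)%E by apply: le_measure; rewrite ?inE//; exact: measurable_hcube.
by rewrite N0 mu_hcube lee_fin leNgt vol_gt0.
Qed.

Lemma weighted_john_nirenberg (W V g : T -> R) (a0 : T -> R) (b A e : R) P :
  0 < b -> 1 <= A -> 0 < e -> (2 + 2 ^+ n) * e <= ln (1 + jn_const b A / 2) ->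
  W = (fun x => expR (a0 x)) -> V = (fun x => expR (- (b * a0 x))) ->
  locint W -> locint V ->
  (forall P, cavg W P * cavg V P `^ b^-1 <= A) ->
  locint g -> (forall P, cint (fun x => `|g x - cavg g P|) P <= e * vol P) ->
  (\int[mu]_(x in hcube P) (expR `|g x - cavg g P| * W x)%:E <=
    (4 / jn_const b A * cint W P)%:E)%E.
Proof.
move=> b0 A1 e0 small WE VE IW IV HA Ig Hg.
have W0 x : 0 < W x by rewrite WE expR_gt0.
have V0 x : 0 < V x by rewrite VE expR_gt0.
set K := 4 / _; set c := cavg g P.
have tree k : leaf_sum (@child R n) k (fun D => expR `|cavg g D - c| * cint W D) P <=
    K * cint W P.
  apply: (@tree_john_nirenberg _ _ _ (@child R n) vol (cint W) (cint V) (cavg g)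
    (fun y => cint (fun x => `|g x - y|)) e (2 ^+ n) b A) => //.
  - exact: vol_gt0.
  - by move=> D; apply: cint_ge0 => x; exact: ltW.
  - by move=> D; exact: cint_gt0.
  - exact: vol_additive.
  - exact: cint_additive.
  - exact: cint_additive.
  - by move=> y; apply/cint_additive/locint_subcst.
  - by move=> y D; apply: cint_ge0.
  - by move=> y D; exact: cavg_sub.
  - by move=> i D; rewrite (vol_child i).
  - move=> t D t0; rewrite -!cintZ// -cintD; [|exact: locintZ..].
    rewrite -[leLHS]mul1r -cint_cst; apply: le_cint.
    + exact: locint_cst.
    + by apply: locintD; exact: locintZ.
    + by move=> x; rewrite WE VE young_expR.
(* Truncating both factors bounds the cost of replacing [g] by its leaf averages by [N.+1 ^ 2] times
   [|g x - cavg g D|], which [dyadic_density] makes small. The tree inequality bounds the rest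
   uniformly in [N]. *)
pose psi (N : nat) x : R := Num.min (expR `|g x - c|) N.+1%:R * Num.min (W x) N.+1%:R.
have psi0 N x : 0 <= psi N x.
  by rewrite mulr_ge0// le_min ?expR_ge0 ?ler0n// (ltW (W0 x)).
have mg : measurable_fun [set: T] (fun x => expR `|g x - c|).
  by apply: measurableT_comp => //; exact: (locint_subcst c Ig).1.
have mpsi N : measurable_fun [set: T] (psi N).
  by apply: measurable_funM; apply: measurable_minr => //; exact: IW.1.
have Ipsi N : locint (psi N).
  apply: (@locint_bounded _ _ _ (N.+1%:R * N.+1%:R)) => // x.
  rewrite ger0_norm// ler_pM//; rewrite ?le_min ?expR_ge0 ?ler0n ?(ltW (W0 x))//.
    by rewrite ge_min lexx orbT.
  by rewrite ge_min lexx orbT.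
have psiK N : cint (psi N) P <= K * cint W P.
  pose M : R := N.+1%:R; have M0 : 0 < M by rewrite ltr0n.
  apply/ler_addgt0Pr => eta eta0.
  have [k Hk] := dyadic_density P Ig (divr_gt0 eta0 (mulr_gt0 M0 M0)).
  rewrite -(leaf_sum_additive k P (cint_additive (Ipsi N))).
  apply: le_trans (lerD (tree k) _); last first.
    by rewrite ler_pdivlMr ?mulr_gt0// mulrC in Hk; exact: Hk.
  rewrite -leaf_sumZ -leaf_sumD; apply: le_leaf_sum => D.
  rewrite -cintZ// -cintZ; last exact: locint_subcst.
  rewrite -cintD; [|exact: locintZ|exact/locintZ/locint_subcst].
  apply: le_cint => //.
    by apply: locintD; [exact: locintZ|exact/locintZ/locint_subcst].
  move=> x; rewrite /psi -/M.
  have H : Num.min (expR `|g x - c|) M <=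
      expR `|cavg g D - c| + M * `|g x - cavg g D|.
    by apply: minr_expR_le => //; rewrite [leRHS]addrC ler_distD.
  apply: (@le_trans _ _ ((expR `|cavg g D - c| + M * `|g x - cavg g D|) * Num.min (W x) M)).
    by rewrite ler_wpM2r// le_min (ltW (W0 x)) ltW.
  rewrite mulrDl lerD//; first by rewrite ler_wpM2l ?expR_ge0// ge_min lexx.
  by rewrite -mulrA [leRHS]mulrAC -mulrA ler_wpM2l ?(ltW M0)// ler_wpM2l// ge_min lexx orbT.
have psi_nd N N' x : (N <= N')%N -> psi N x <= psi N' x.
  move=> NN'; have h : N.+1%:R <= N'.+1%:R :> R by rewrite ler_nat ltnS.
  rewrite /psi ler_pM ?le_min ?expR_ge0 ?ler0n ?(ltW (W0 x))//.
  - by rewrite !ge_min lexx h orbT.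
  - by rewrite !ge_min lexx h orbT.
have lim x : limn (fun N => (psi N x)%:E) = (expR `|g x - c| * W x)%:E.
  apply: lim_near_cst => //.
  pose N0 := Num.bound (Num.max (expR `|g x - c|) (W x)).
  exists N0 => // N /= N0N; congr EFin.
  have := archi_boundP (_ : 0 <= Num.max (expR `|g x - c|) (W x)).
  rewrite le_max expR_ge0 => /(_ isT); rewrite -/N0 gt_max => /andP[h1 h2].
  have h3 : N0%:R <= N.+1%:R :> R by rewrite ler_nat (leq_trans N0N).
  by rewrite /psi !min_l// (le_trans (ltW _) h3).
have := @monotone_convergence _ _ _ mu (hcube P) (measurable_hcube P)
  (fun N x => (psi N x)%:E).
under eq_integral do rewrite lim.
move=> ->.
- apply: lime_le.
    apply: ereal_nondecreasing_is_cvgn => N N' NN'.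
    apply: ge0_le_integral => //.
    + exact: measurable_hcube.
    + by move=> x _; rewrite lee_fin.
    + by apply/measurable_EFinP; apply: measurable_funS (mpsi N).
    + by apply/measurable_EFinP; apply: measurable_funS (mpsi N').
    + by move=> x _; rewrite lee_fin psi_nd.
  by apply: nearW => N; rewrite locint_EFin// lee_fin.
- by move=> N; apply/measurable_EFinP; apply: measurable_funS (mpsi N).
- by move=> N x _; rewrite lee_fin.
- by move=> x _ N N' NN'; rewrite lee_fin psi_nd.
Qed.

End WeightedJohnNirenberg.

(** * Weights in logarithmic form *)

Section LogWeights.
Context {R : realType} {n : nat}.
Local Notation mu := (@lebesgue_measure_tuple R n).
Local Notation T := (n.-tuple R).
Local Notation node := (@node R n).
Implicit Types (f g a w : T -> R) (P : node).

Lemma integral_cube (f : T -> \bar R) (P : node) : measurable_fun [set: T] f ->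
  (\int[mu]_(x in cube P.1 P.2%:num) f x = \int[mu]_(x in hcube P) f x)%E.
Proof.
move=> mf; have [mC muC] := @lebesgue_measure_cube R n P.1 P.2%:num (ltW [gt0 of P.2%:num]).
have mH := measurable_hcube P.
have sub : hcube P `<=` cube P.1 P.2%:num.
  by move=> x H i; have /andP[-> /ltW ->] := H i.
rewrite -[in LHS](setDUK sub) integral_setU//.
- rewrite (null_set_integral (N := cube P.1 P.2%:num `\` hcube P))//.
  + by rewrite adde0.
  + exact: measurableD.
  + exact: measurable_funS mf.
  + rewrite measureD//=; last by rewrite muC ltry.
    by rewrite setIidr// mu_hcube muC subee.
- exact: measurableD.
- exact: measurable_funS mf.
- by apply/disj_setPRL; exact: subDsetr.
Qed.

Lemma average_cube (f : T -> \bar R) (P : node) : measurable_fun [set: T] f ->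
  average (cube P.1 P.2%:num) f =
  ((vol P)^-1%:E * \int[mu]_(x in hcube P) f x)%E.
Proof.
move=> mf; rewrite /average integral_cube//.
by have [_ ->] := @lebesgue_measure_cube R n P.1 P.2%:num (ltW [gt0 of P.2%:num]).
Qed.

Lemma average_locint f P : locint f ->
  average (cube P.1 P.2%:num) (fun x => (f x)%:E) = (cavg f P)%:E.
Proof.
move=> If; rewrite average_cube; last by apply/measurable_EFinP; exact: If.1.
by rewrite locint_EFin// -EFinM mulrC.
Qed.

Lemma cube_cubes P : cubes (cube P.1 P.2%:num).
Proof. by exists P.1, P.2%:num. Qed.

Lemma cubesP Q : cubes Q -> exists P : node, Q = cube P.1 P.2%:num.
Proof. by move=> [a [h [h0 ->]]]; exists (a, PosNum h0). Qed.

Lemma nonneg_locint f : measurable_fun [set: T] f -> (forall x, 0 <= f x) ->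
  (forall P, \int[mu]_(x in hcube P) (f x)%:E < +oo)%E -> locint f.
Proof.
move=> mf f0 fy; split=> // P; apply/integrableP; split.
  by apply/measurable_EFinP; exact: measurable_funS mf.
by under eq_integral do rewrite /= ger0_norm//.
Qed.

Lemma BMO_norm_le g (e : R) : measurable_fun [set: T] g ->
  (BMO_norm g <= e%:E)%E ->
  locint g /\ forall P, cint (fun x => `|g x - cavg g P|) P <= e * vol P.
Proof.
move=> mg H.
have H1 P (c := fine (average (cube P.1 P.2%:num) (fun y => (g y)%:E))) :
    (\int[mu]_(x in hcube P) (`|g x - c|)%:E <= (e * vol P)%:E)%E.
  have : (average (cube P.1 P.2%:num) (fun x => `|g x - c|%:E) <= e%:E)%E.
    apply: le_trans H; apply: ereal_sup_ubound.
    by exists (cube P.1 P.2%:num); first exact: cube_cubes.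
  rewrite average_cube; last first.
    apply/measurable_EFinP; apply: measurableT_comp => //.
    by apply: measurable_funB.
  by rewrite -(@lee_pmul2l _ (vol P)%:E) ?lte_fin ?vol_gt0// muleA -EFinM divff
    ?gt_eqF ?vol_gt0// mul1e -EFinM mulrC.
have Ig : locint g.
  (* Until [g] is known to be integrable, [c] may be a default value of [fine]; integrability of
     [g - c] for any real [c] suffices. *)
  split=> // P; set c := fine (average (cube P.1 P.2%:num) (fun y => (g y)%:E)).
  have Ic : mu.-integrable (hcube P) (EFin \o (fun x => g x - c)).
    apply/integrableP; split.
      by apply/measurable_EFinP; apply: measurable_funB => //; exact: measurable_funS mg.
    by apply: le_lt_trans (H1 P) _; rewrite ltry.
  have := integrableD (measurable_hcube P) Ic ((locint_cst c).2 P).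
  apply: eq_integrable; first exact: measurable_hcube.
  by move=> x _ /=; rewrite -EFinD subrK.
split=> // P; have := H1 P; rewrite average_locint//= locint_EFin ?lee_fin//.
exact: locint_subcst.
Qed.

Variable p : R.
Hypothesis p1 : 1 < p.
Let p10 : 0 < p - 1. Proof. by rewrite subr_gt0. Qed.
Local Notation b := (p - 1)^-1.
Let b0 : 0 < b. Proof. by rewrite invr_gt0. Qed.

(* [expR \o a] is an A_p weight with constant at most [A]; the second exponential
   is its dual weight [w `^ (1 - p')]. *)
Definition logAp a (A : R) : Prop := [/\ measurable_fun [set: T] a,
  locint (fun x => expR (a x)), locint (fun x => expR (- (b * a x))) &
  forall P, cavg (fun x => expR (a x)) P *
    cavg (fun x => expR (- (b * a x))) P `^ (p - 1) <= A].

Lemma expR_dual a x : expR (a x) `^ (1 - conj_exponent p) = expR (- (b * a x)).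
Proof.
rewrite -expRM; congr expR; rewrite /conj_exponent; field.
by rewrite gt_eqF.
Qed.

Lemma cavg_gt0 f P : locint f -> (forall x, 0 < f x) -> 0 < cavg f P.
Proof. by move=> If f0; rewrite divr_gt0 ?cint_gt0 ?vol_gt0. Qed.

Lemma logAp_Ap a A : logAp a A ->
  Ap p (fun x => expR (a x)) /\ (Ap_const p (fun x => expR (a x)) <= A%:E)%E.
Proof.
move=> [ma IW IV HA].
have H : (Ap_const p (fun x => expR (a x)) <= A%:E)%E.
  apply: ge_ereal_sup => _ [Q /cubesP[P ->] <-].
  under [X in (_ * average _ X `^ _)%E]eq_fun do rewrite expR_dual.
  rewrite !average_locint// poweR_EFin -EFinM lee_fin; exact: HA.
split=> //; split; last by apply: le_lt_trans H _; rewrite ltry.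
split; first exact: IW.1.
- move=> Q /cubesP[P ->]; rewrite integral_cube; last first.
    by apply/measurable_EFinP; apply: measurableT_comp => //; exact: IW.1.
  by rewrite locint_EFin ?ltry//; exact: locint_abs.
- by apply: aeW => x; exact: expR_gt0.
Qed.

Lemma Ap_logAp a : measurable_fun [set: T] a -> Ap p (fun x => expR (a x)) ->
  Ap_const p (fun x => expR (a x)) = (fine (Ap_const p (fun x => expR (a x))))%:E /\
  logAp a (fine (Ap_const p (fun x => expR (a x)))).
Proof.
move=> ma [[mw wy _] Ay].
have mV : measurable_fun [set: T] (fun x => expR (- (b * a x))).
  by apply: measurableT_comp => //; apply: measurableT_comp => //; apply: measurable_funM.
have IW : locint (fun x => expR (a x)).
  apply: nonneg_locint => // P.
  have := wy _ (cube_cubes P); rewrite integral_cube; last first.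
    by apply/measurable_EFinP; apply: measurableT_comp.
  by under eq_integral do rewrite ger0_norm ?expR_ge0//.
have H P : ((cavg (fun x => expR (a x)) P)%:E *
    (average (cube P.1 P.2%:num) (fun x => (expR (- (b * a x)))%:E)) `^ (p - 1) <=
    Ap_const p (fun x => expR (a x)))%E.
  apply: ereal_sup_ubound; exists (cube P.1 P.2%:num); first exact: cube_cubes.
  rewrite average_locint//.
  by under [X in (_ * average _ X `^ _)%E]eq_fun do rewrite expR_dual.
have W0 P : 0 < cavg (fun x => expR (a x)) P by apply: cavg_gt0 => // x; exact: expR_gt0.
have IV : locint (fun x => expR (- (b * a x))).
  apply: nonneg_locint => // P.
  (* Local integrability of the dual weight is extracted from the constant: an infinite dual average
     times a positive average of the weight would make it infinite. *)
  rewrite ltNge; apply/negP; rewrite leye_eq => /eqP E.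
  move: (H P); rewrite average_cube; last exact/measurable_EFinP.
  rewrite E gt0_muley ?lte_fin ?invr_gt0 ?vol_gt0//.
  rewrite poweRyr ?gt_eqF// gt0_muley ?lte_fin//.
  by rewrite leye_eq => /eqP E'; move: Ay; rewrite E'.
have A0 P : (0 <= Ap_const p (fun x => expR (a x)))%E.
  by apply: le_trans (H P); rewrite mule_ge0 ?poweR_ge0// lee_fin ltW.
have Afin : Ap_const p (fun x => expR (a x)) \is a fin_num.
  by rewrite ge0_fin_numE// (A0 ([tuple 0 | i < n], PosNum ltr01)).
split; first by rewrite fineK.
split=> // P; have := H P; rewrite average_locint// poweR_EFin -EFinM.
by rewrite -[X in (_ <= X)%E -> _]fineK// lee_fin.
Qed.

(** The tangent line at [th * x] bounds the exponential from below at [x] and at 0; the convex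
    combination cancels the linear terms. *)
Lemma expR_jensen (th x : R) : 0 <= th -> th <= 1 ->
  expR (th * x) <= th * expR x + (1 - th).
Proof.
move=> t0 t1; set y := expR (th * x); have y0 : 0 <= y := expR_ge0 _.
have h1 : y * (1 + (1 - th) * x) <= expR x.
  have -> : expR x = y * expR ((1 - th) * x) by rewrite -expRD; congr expR; ring.
  by rewrite ler_wpM2l// expR_ge1Dx.
have h2 : y * (1 - th * x) <= 1.
  have e1 : y * expR (- (th * x)) = 1 by rewrite expRxMexpNx_1.
  by rewrite -[leRHS]e1 ler_wpM2l// expR_ge1Dx.
rewrite [leLHS](_ : _ = th * (y * (1 + (1 - th) * x)) + (1 - th) * (y * (1 - th * x))); last by ring.
have : 0 <= 1 - th by rewrite subr_ge0.
nra.
Qed.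

(** Jensen's inequality for the power [th], obtained by integrating [expR_jensen] after normalizing
    by the average [c]. *)
Lemma cavg_expR_le (u : T -> R) (th : R) : 0 <= th -> th <= 1 ->
  measurable_fun [set: T] u -> locint (fun x => expR (u x)) ->
  locint (fun x => expR (th * u x)) /\
  forall P, cavg (fun x => expR (th * u x)) P <= cavg (fun x => expR (u x)) P `^ th.
Proof.
move=> t0 t1 mu' Iu.
have mtu : measurable_fun [set: T] (fun x => expR (th * u x)).
  by apply: measurableT_comp => //; apply: measurable_funM.
have It : locint (fun x => expR (th * u x)).
  have I1 : locint (fun x => th * expR (u x) + (1 - th)).
    by apply: locintD; [exact: locintZ|exact: locint_cst].
  apply: (locint_dom mtu I1) => x.
  rewrite ger0_norm ?expR_ge0// (le_trans (expR_jensen _ t0 t1))// ler_norm//.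
split=> // P; have c0 : 0 < cavg (fun x => expR (u x)) P.
  by apply: cavg_gt0 => // x; exact: expR_gt0.
set c := cavg _ P in c0 *.
have cE : c `^ th = expR (th * ln c) by rewrite -[c in LHS]lnK ?posrE// -expRM mulrC.
rewrite ler_pdivrMr ?vol_gt0// cE -cint_cst.
have key x : expR (th * u x) <= expR (th * ln c) * (th / c * expR (u x) + (1 - th)).
  have := ler_wpM2l (expR_ge0 (th * ln c)) (expR_jensen (u x - ln c) t0 t1).
  rewrite -expRD expRB lnK ?posrE// mulrBr addrC subrK => /le_trans; apply.
  by rewrite ler_wpM2l ?expR_ge0// lerD2r mulrAC mulrA.
apply: (@le_trans _ _ (cint (fun x => expR (th * ln c) *
    (th / c * expR (u x) + (1 - th))) P)).
  apply: le_cint => //; apply: locintZ; apply: locintD; [exact: locintZ|exact: locint_cst].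
rewrite cintZ; last by apply: locintD; [exact: locintZ|exact: locint_cst].
rewrite cintD; [|exact: locintZ|exact: locint_cst].
rewrite cintZ// !cint_cst ler_wpM2l ?expR_ge0//.
rewrite le_eqVlt; apply/orP; left; apply/eqP.
have -> : cint (fun x => expR (u x)) P = c * vol P by rewrite /c /cavg divfK// gt_eqF// vol_gt0.
by field; rewrite gt_eqF.
Qed.

(** With [c] the average of the weight, two tangent-line bounds give
    [1 <= c^b * w^(-b) + b * w / c - b] pointwise; the last two terms cancel on average, leaving
    [1 <= c^b * d]. *)
Lemma logAp_ge1 a A : logAp a A -> 1 <= A.
Proof.
move=> [ma IW IV HA]; pose P : node := ([tuple 0 | i < n], PosNum ltr01).
apply: (le_trans _ (HA P)).
set c := cavg _ P; set d := cavg _ P.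
have c0 : 0 < c by apply: cavg_gt0 => // x; exact: expR_gt0.
have d0 : 0 < d by apply: cavg_gt0 => // x; exact: expR_gt0.
have v0 := vol_gt0 P.
have cW : cint (fun x => expR (a x)) P = c * vol P by rewrite /c /cavg divfK// gt_eqF.
have dV : cint (fun x => expR (- (b * a x))) P = d * vol P by rewrite /d /cavg divfK// gt_eqF.
have key x : 1 <= expR (b * ln c) * expR (- (b * a x)) + b / c * expR (a x) - b.
  rewrite -expRD.
  have h1 := expR_ge1Dx (b * ln c - b * a x).
  have := expR_ge1Dx (a x - ln c); rewrite expRB lnK ?posrE// => h2.
  have := ler_wpM2l (ltW b0) h2.
  have -> : b / c * expR (a x) = b * (expR (a x) / c) by rewrite mulrAC mulrA.
  lra.
have I1 : locint (fun x => expR (b * ln c) * expR (- (b * a x))) by exact: locintZ.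
have I2 : locint (fun x => b / c * expR (a x)) by exact: locintZ.
have : cint (fun=> 1) P <= cint (fun x =>
    expR (b * ln c) * expR (- (b * a x)) + b / c * expR (a x) - b) P.
  apply: le_cint => //; first exact: locint_cst.
  by apply: locintB; [exact: locintD|exact: locint_cst].
rewrite cintB; [|exact: locintD|exact: locint_cst].
rewrite cintD// !cintZ// cW dV !cint_cst.
have -> : expR (b * ln c) * (d * vol P) + b / c * (c * vol P) - b * vol P =
    expR (b * ln c) * d * vol P.
  by field; rewrite !gt_eqF.
rewrite ler_pM2r// => H.
have cE : c = expR (b * ln c) `^ (p - 1).
  by rewrite -expRM mulrAC mulVf ?gt_eqF// mul1r lnK ?posrE.
rewrite {1}cE -powRM ?expR_ge0 ?(ltW d0)//.
have one : 1 `^ (p - 1) = 1 :> R by rewrite powR1.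
rewrite -[leLHS]one ge0_ler_powR ?nnegrE// ?(ltW p10)//.
by rewrite mulr_ge0 ?expR_ge0 ?(ltW d0).
Qed.

Lemma Ap_power_le (x y u v A r : R) : 0 < x -> 0 < y -> 0 <= u -> 0 <= v ->
  1 <= A -> 0 <= r -> x * y `^ (p - 1) <= A -> u <= y `^ (r * (p - 1)) ->
  v <= x `^ (r * b) -> u * v `^ (p - 1) <= A `^ r.
Proof.
move=> x0 y0 u0 v0 A1 r0 xyA uy vx.
apply: (@le_trans _ _ ((x * y `^ (p - 1)) `^ r)).
  rewrite powRM ?powR_ge0 ?(ltW x0)// [leRHS]mulrC.
  apply: ler_pM => //; first exact: powR_ge0.
    by rewrite -powRrM [(p - 1) * r]mulrC.
  apply: (@le_trans _ _ ((x `^ (r * b)) `^ (p - 1))).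
    by rewrite ge0_ler_powR ?nnegrE ?powR_ge0 ?(ltW p10).
  by rewrite -powRrM -mulrA mulVf ?mulr1// gt_eqF.
rewrite ge0_ler_powR ?nnegrE//; last exact: le_trans ler01 _.
by rewrite mulr_ge0 ?powR_ge0// ltW.
Qed.

(** A negative power exchanges the two factors of the A_p product: [w^(-r)] is the power
    [r * (p - 1)] of the dual weight, and its own dual is [w^(r * b)]. Both powers are at most 1, so
    Jensen's inequality applies. *)
Lemma logAp_opp_pow a A (r : R) : logAp a A -> 0 <= r -> r <= b -> r * b <= 1 ->
  logAp (fun x => - (r * a x)) (A `^ r).
Proof.
move=> [ma IW IV HA] r0 rb rb1.
have mra : measurable_fun [set: T] (fun x => - (r * a x)).
  by apply: measurableT_comp => //; apply: measurable_funM.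
have mba : measurable_fun [set: T] (fun x => - (b * a x)).
  by apply: measurableT_comp => //; apply: measurable_funM.
have t0 : 0 <= r * (p - 1) by rewrite mulr_ge0// ltW.
have t1 : r * (p - 1) <= 1 by rewrite -ler_pdivlMr// mul1r.
have s0 : 0 <= r * b by rewrite mulr_ge0// ltW.
have [I1 H1] := cavg_expR_le t0 t1 mba IV.
have [I2 H2] := cavg_expR_le s0 rb1 ma IW.
have E1 : (fun x => expR (r * (p - 1) * - (b * a x))) = (fun x => expR (- (r * a x))).
  by apply/funext => x; congr expR; field; rewrite gt_eqF.
have E2 : (fun x => expR (r * b * a x)) = (fun x => expR (- (b * - (r * a x)))).
  by apply/funext => x; congr expR; ring.
rewrite E1 in I1 H1; rewrite E2 in I2 H2.
split=> // P.
exact: (Ap_power_le (cavg_gt0 P IW (fun x => expR_gt0 _))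
  (cavg_gt0 P IV (fun x => expR_gt0 _)) (ltW (cavg_gt0 P I1 (fun x => expR_gt0 _)))
  (ltW (cavg_gt0 P I2 (fun x => expR_gt0 _))) (logAp_ge1 (And4 ma IW IV HA)) r0
  (HA P) (H1 P) (H2 P)).
Qed.

End LogWeights.

(** * Stability of the A_p class *)

Section Stability.
Context {R : realType} {n : nat}.
Local Notation mu := (@lebesgue_measure_tuple R n).
Local Notation T := (n.-tuple R).
Local Notation node := (@node R n).
Implicit Types (f g a w : T -> R) (P : node).

(** With [c] the average of [g] on the cube, [expR (a + g) <= expR c * expR |g - c| * expR a]. *)
Lemma john_nirenberg_expR a g (b A e : R) : 0 < b -> 1 <= A -> 0 < e ->
  (2 + 2 ^+ n) * e <= ln (1 + jn_const b A / 2) -> measurable_fun [set: T] a ->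
  locint (fun x => expR (a x)) -> locint (fun x => expR (- (b * a x))) ->
  (forall P, cavg (fun x => expR (a x)) P *
    cavg (fun x => expR (- (b * a x))) P `^ b^-1 <= A) ->
  locint g -> (forall P, cint (fun x => `|g x - cavg g P|) P <= e * vol P) ->
  locint (fun x => expR (a x + g x)) /\
  forall P, cavg (fun x => expR (a x + g x)) P <=
    4 / jn_const b A * (expR (cavg g P) * cavg (fun x => expR (a x)) P).
Proof.
move=> b0 A1 e0 small ma IW IV HA Ig Hg.
have mag : measurable_fun [set: T] (fun x => expR (a x + g x)).
  by apply: measurableT_comp => //; apply: measurable_funD => //; exact: Ig.1.
have H P : (\int[mu]_(x in hcube P) (expR (a x + g x))%:E <=
    (expR (cavg g P) * (4 / jn_const b A * cint (fun x => expR (a x)) P))%:E)%E.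
  have := weighted_john_nirenberg P b0 A1 e0 small erefl erefl IW IV HA Ig Hg.
  set c := cavg g P => JN.
  have mg : measurable_fun [set: T] (fun x => expR `|g x - c| * expR (a x)).
    apply: measurable_funM; last exact: IW.1.
    by apply: measurableT_comp => //; exact: (locint_subcst c Ig).1.
  have m2 : measurable_fun (hcube P) (fun x => (expR `|g x - c| * expR (a x))%:E).
    by apply/measurable_EFinP; apply: measurable_funS mg.
  have cJN := lee_wpmul2l (_ : (0 <= (expR c)%:E)%E) JN.
  rewrite EFinM; apply: le_trans (cJN _); last by rewrite lee_fin expR_ge0.
  rewrite -ge0_integralZl_EFin; last 4 first.
  - exact: measurable_hcube.
  - by move=> x _; rewrite lee_fin mulr_ge0 ?expR_ge0.
  - exact: m2.
  - exact: expR_ge0.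
  apply: ge0_le_integral.
  - exact: measurable_hcube.
  - by move=> x _; rewrite lee_fin expR_ge0.
  - by apply/measurable_EFinP; apply: measurable_funS mag.
  - apply/measurable_EFinP; apply: measurable_funM => //.
    by apply: measurable_funS mg.
  - move=> x _; rewrite -EFinM lee_fin -!expRD ler_expR.
    have := ler_norm (g x - c); lra.
have Iag : locint (fun x => expR (a x + g x)).
  apply: nonneg_locint => // P; apply: le_lt_trans (H P) _; exact: ltry.
split=> // P; rewrite ler_pdivrMr ?vol_gt0//.
have := H P; rewrite locint_EFin// lee_fin => /le_trans; apply.
rewrite [leLHS](_ : _ = 4 / jn_const b A * (expR (cavg g P) * cint (fun x => expR (a x)) P)); last by ring.
have -> : cint (fun x => expR (a x)) P = cavg (fun x => expR (a x)) P * vol P.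
  by rewrite /cavg divfK// gt_eqF// vol_gt0.
by rewrite !mulrA.
Qed.

Variable p : R.
Hypothesis p1 : 1 < p.
Local Notation b := (p - 1)^-1.
Let p10 : 0 < p - 1. Proof. by rewrite subr_gt0. Qed.
Let b0 : 0 < b. Proof. by rewrite invr_gt0. Qed.

Definition stab_radius (A : R) : R :=
  Num.min (ln (1 + jn_const b A / 2)) (ln (1 + jn_const (p - 1) (A `^ b) / 2) / b) /
  (2 + 2 ^+ n).

Definition stab_const (A : R) : R :=
  4 / jn_const b A * (4 / jn_const (p - 1) (A `^ b)) `^ (p - 1) * A.

Lemma jn_const_gt0 (B A : R) : 0 < A -> 0 < jn_const B A.
Proof. by move=> A0; rewrite /jn_const invr_gt0 !mulr_gt0// powR_gt0. Qed.

Let D0 : 0 < 2 + 2 ^+ n :> R.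
Proof. by rewrite addr_gt0// exprn_gt0. Qed.

Lemma stab_radius_gt0 A : 1 <= A -> 0 < stab_radius A.
Proof.
move=> A1; have A0 : 0 < A by exact: lt_le_trans A1.
have h (B A' : R) : 0 < A' -> 0 < ln (1 + jn_const B A' / 2).
  move=> A'0; have j0 := jn_const_gt0 B A'0.
  by rewrite ln_gt0// ltrDl divr_gt0.
by rewrite divr_gt0// lt_min h//= divr_gt0// h// powR_gt0.
Qed.

Lemma cavgZ f (k : R) P : locint f -> cavg (fun x => k * f x) P = k * cavg f P.
Proof. by move=> If; rewrite /cavg cintZ// mulrA. Qed.

Lemma oscZ g (k e : R) : locint g ->
  (forall P, cint (fun x => `|g x - cavg g P|) P <= e * vol P) ->
  forall P, cint (fun x => `|k * g x - cavg (fun y => k * g y) P|) P <=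
    `|k| * e * vol P.
Proof.
move=> Ig H P; rewrite cavgZ//.
rewrite (_ : (fun x => _) = (fun x => `|k| * `|g x - cavg g P|)).
  by rewrite cintZ -?mulrA ?ler_wpM2l//; exact: locint_subcst.
by apply/funext => x; rewrite -mulrBr normrM.
Qed.

Lemma logAp_stable a g A : 1 <= A -> logAp p a A -> locint g ->
  (forall P, cint (fun x => `|g x - cavg g P|) P <= stab_radius A * vol P) ->
  logAp p (fun x => a x + g x) (stab_const A).
Proof.
move=> A1 [ma IW IV HA] Ig Hg.
have A0 : 0 < A by exact: lt_le_trans A1.
have e0 := stab_radius_gt0 A1; set e := stab_radius A in e0 Hg.
have Ab1 : 1 <= A `^ b.
  have one : 1 `^ b = 1 :> R by rewrite powR1.
  by rewrite -[leLHS]one ge0_ler_powR ?nnegrE// ltW.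
have De : (2 + 2 ^+ n) * e = Num.min (ln (1 + jn_const b A / 2))
    (ln (1 + jn_const (p - 1) (A `^ b) / 2) / b).
  by rewrite /e /stab_radius mulrCA divff ?mulr1// gt_eqF.
have s1 : (2 + 2 ^+ n) * e <= ln (1 + jn_const b A / 2).
  by rewrite De ge_min lexx.
have s2 : (2 + 2 ^+ n) * (b * e) <= ln (1 + jn_const (p - 1) (A `^ b) / 2).
  rewrite mulrCA -ler_pdivlMl// [leRHS]mulrC.
  by rewrite De ge_min lexx orbT.
have HA' P : cavg (fun x => expR (a x)) P *
    cavg (fun x => expR (- (b * a x))) P `^ b^-1 <= A by rewrite invrK.
have [I1 H1] := john_nirenberg_expR b0 A1 e0 s1 ma IW IV HA' Ig Hg.
have mba : measurable_fun [set: T] (fun x => - (b * a x)).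
  by apply: measurableT_comp => //; apply: measurable_funM.
have W0 P : 0 < cavg (fun x => expR (a x)) P := cavg_gt0 P IW (fun x => expR_gt0 _).
have V0 P : 0 < cavg (fun x => expR (- (b * a x))) P := cavg_gt0 P IV (fun x => expR_gt0 _).
have EW : (fun x => expR (- ((p - 1) * - (b * a x)))) = (fun x => expR (a x)).
  by apply/funext => x; congr expR; field; rewrite gt_eqF.
have HB P : cavg (fun x => expR (- (b * a x))) P *
    cavg (fun x => expR (- ((p - 1) * - (b * a x)))) P `^ (p - 1)^-1 <= A `^ b.
  rewrite EW; move: (HA P) (W0 P) (V0 P).
  move: (cavg (fun x => expR (a x)) P) (cavg (fun x => expR (- (b * a x))) P).
  move=> x y xy x0 y0.
  have yE : (y `^ (p - 1)) `^ b = y by rewrite -powRrM divff ?powRr1 ?gt_eqF// ltW.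
  rewrite -{1}yE.
  rewrite -powRM ?powR_ge0 ?(ltW x0)// mulrC.
  by rewrite ge0_ler_powR ?nnegrE ?(ltW b0) ?(ltW A0)// mulr_ge0 ?powR_ge0// ltW.
pose g' := fun x => - b * g x.
have Ig' : locint g' by exact: locintZ.
have Hg' P : cint (fun x => `|g' x - cavg g' P|) P <= b * e * vol P.
  by rewrite -[b in leRHS]ger0_norm ?(ltW b0)// -normrN; exact: oscZ.
have IW' : locint (fun x => expR (- ((p - 1) * - (b * a x)))) by rewrite EW.
have [I2 H2] := john_nirenberg_expR p10 Ab1 (mulr_gt0 b0 e0) s2 mba IV IW' HB Ig' Hg'.
have E2 : (fun x => expR (- (b * a x) + g' x)) = (fun x => expR (- (b * (a x + g x)))).
  by apply/funext => x; congr expR; rewrite /g'; ring.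
rewrite E2 in I2 H2.
split=> // [|P]; first by apply: measurable_funD => //; exact: Ig.1.
move: (H1 P) (H2 P) (HA P) (W0 P) (V0 P) (cavg_gt0 P I1 (fun x => expR_gt0 _))
  (cavg_gt0 P I2 (fun x => expR_gt0 _)).
rewrite /g' cavgZ// /stab_const.
have := jn_const_gt0 b A0; have := jn_const_gt0 (p - 1) (powR_gt0 b A0).
move: (jn_const (p - 1) (A `^ b)) (jn_const b A) => k2 k1 k20 k10.
move: (cavg g P) => c.
move: (cavg (fun x => expR (a x + g x)) P) (cavg (fun x => expR (a x)) P)
  (cavg (fun x => expR (- (b * (a x + g x)))) P)
  (cavg (fun x => expR (- (b * a x))) P).
move=> w' w v' v h1 h2 h3 w0 v0 w'0 v'0.
have K1 : 0 < 4 / k1 by rewrite divr_gt0.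
have K2 : 0 < 4 / k2 by rewrite divr_gt0.
apply: (@le_trans _ _ (4 / k1 * (expR c * w) *
   (4 / k2 * (expR (- b * c) * v)) `^ (p - 1))).
  apply: ler_pM => //; [exact: ltW|exact: powR_ge0|].
  apply: ge0_ler_powR; rewrite ?nnegrE; [exact: ltW|exact: ltW| |exact: h2].
  by rewrite !mulr_ge0 ?expR_ge0 ?(ltW v0) ?invr_ge0 ?(ltW k20).
rewrite powRM ?(ltW K2) ?mulr_ge0 ?expR_ge0 ?(ltW v0)//.
rewrite powRM ?expR_ge0 ?(ltW v0)// -expRM.
(* The average of [g] enters the two factors as [expR c] and [expR (- c)], so no bound on it is
   needed. *)
have -> : - b * c * (p - 1) = - c by field; rewrite gt_eqF.
rewrite [leLHS](_ : _ = 4 / k1 * (4 / k2) `^ (p - 1) * (w * v `^ (p - 1)) *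
  (expR c * expR (- c))); last by ring.
rewrite expRxMexpNx_1 mulr1 ler_wpM2l// mulr_ge0 ?powR_ge0// ltW//.
Qed.

End Stability.

(** * Continuity of the operator norm *)

Lemma aeI (R : realType) (n : nat) (P Q : n.-tuple R -> Prop) :
  {ae lebesgue_measure_tuple n, forall x, P x} ->
  {ae lebesgue_measure_tuple n, forall x, Q x} ->
  {ae lebesgue_measure_tuple n, forall x, P x /\ Q x}.
Proof. by move=> HP HQ; near=> x; split; near: x. Unshelve. all: by end_near. Qed.

Section Continuity.
Context {R : realType} {s : scalars} {n : nat}.
Local Notation mu := (@lebesgue_measure_tuple R n).
Local Notation T := (n.-tuple R).
Local Notation fct := (T -> scalar R s).
Implicit Types (f g : fct) (a w : T -> R) (S : operator R s n).

Variables (p : R) (F : R -> R) (c : R).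
Hypothesis p1 : 1 < p.
Hypothesis Fmono : forall x y : R, 1 <= x -> x <= y -> F x <= F y.
Hypothesis c0 : 0 < c.
Local Notation b := (p - 1)^-1.
Let p10 : 0 < p - 1. Proof. by rewrite subr_gt0. Qed.
Let b0 : 0 < b. Proof. by rewrite invr_gt0. Qed.
Let p0 : 0 < p. Proof. exact: lt_trans p1. Qed.

Lemma bounded_on_le S w (M M' : R) : (forall x, 0 <= w x) -> 0 <= M -> M <= M' ->
  bounded_on p S w M -> bounded_on p S w M'.
Proof.
move=> w0 M0 MM' [dom mS bd]; split=> // f Lf.
apply: le_trans (bd _ Lf) _; apply: lee_wpmul2r; first exact: pint_ge0.
by rewrite lee_fin ge0_ler_powR ?nnegrE ?(ltW p0)// (le_trans M0).
Qed.

Variable S : operator R s n.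
Hypothesis wb : weighted_bound p F c S.

Lemma opnorm_logAp a A : logAp p a A -> exists N : R,
  [/\ opnorm p (fun x => expR (a x)) S = N%:E, 0 <= N, N <= c * F A &
    bounded_on p S (fun x => expR (a x)) N].
Proof.
move=> La; have [Aa Ale] := logAp_Ap p1 La.
have [dom mS le] := wb Aa.
have N0 := opnorm_ge0 p (fun x => expR (a x)) S.
have ma : measurable_fun [set: T] a by case: La.
have [AE La'] := Ap_logAp p1 ma Aa.
have Nfin : opnorm p (fun x => expR (a x)) S \is a fin_num.
  by rewrite ge0_fin_numE// (le_lt_trans le)// ltry.
have Nge : 0 <= fine (opnorm p (fun x => expR (a x)) S) by exact: fine_ge0.
exists (fine (opnorm p (fun x => expR (a x)) S)); split=> //.
- by rewrite fineK.
- rewrite -lee_fin fineK//; apply: le_trans le _.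
  rewrite lee_fin ler_wpM2l ?(ltW c0)//; apply: Fmono; first exact: logAp_ge1 La'.
  by rewrite -lee_fin -AE.
- split=> //; apply/(opnorm_leP p1 _ (fun x => expR_ge0 (a x)) Nge).
  by rewrite fineK.
Qed.

Lemma logAp_le a (A A' : R) : A <= A' -> logAp p a A -> logAp p a A'.
Proof. by move=> AA' [ma IW IV HA]; split=> // P; exact: le_trans (HA P) AA'. Qed.

Lemma logAp0 : logAp p (fun=> 0 : R) 1 (n := n).
Proof.
split=> // [||P].
- exact: locint_cst.
- exact: locint_cst.
have E (k : R) : cavg (fun=> k) P = k.
  by rewrite /cavg cint_cst mulfK// gt_eqF// vol_gt0.
by rewrite !E mulr0 oppr0 expR0 powR1 mulr1.
Qed.

Hypothesis subS : sublinear_operator S.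

Lemma pint_le w w' f g : (forall x, 0 <= w x) ->
  measurable_fun [set: T] w -> measurable_fun [set: T] w' ->
  scalar_measurable f -> scalar_measurable g ->
  (forall x, modulus (f x) `^ p * w x <= modulus (g x) `^ p * w' x) ->
  (pint p w f <= pint p w' g)%E.
Proof.
move=> w0 mw mw' mf mg H; apply: ge0_le_integral.
- exact: measurableT.
- by move=> x _; rewrite lee_fin mulr_ge0// powR_ge0.
- by apply/measurable_EFinP; exact: measurable_pint.
- by apply/measurable_EFinP; exact: measurable_pint.
- by move=> x _; rewrite lee_fin.
Qed.

Lemma ae_pint_le w f g : (forall x, 0 <= w x) ->
  measurable_fun [set: T] w -> scalar_measurable f -> scalar_measurable g ->
  {ae mu, forall x, modulus (f x) <= modulus (g x)} ->
  (pint p w f <= pint p w g)%E.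
Proof.
move=> w0 mw mf mg H; apply: ae_ge0_le_integral.
- exact: measurableT.
- by move=> x _; rewrite lee_fin mulr_ge0// powR_ge0.
- by apply/measurable_EFinP; exact: measurable_pint.
- by move=> x _; rewrite lee_fin mulr_ge0// powR_ge0.
- by apply/measurable_EFinP; exact: measurable_pint.
- apply: (ae_imply H) => x Hx _; rewrite lee_fin ler_wpM2r//.
  by rewrite ge0_ler_powR ?nnegrE ?modulus_ge0// ltW.
Qed.

Lemma pint_le0 w f : (forall x, 0 < w x) -> measurable_fun [set: T] w ->
  scalar_measurable f -> (pint p w f <= 0)%E ->
  {ae mu, forall x, modulus (f x) = 0}.
Proof.
move=> w0 mw mf I0.
have m : measurable_fun [set: T] (fun x => (modulus (f x) `^ p * w x)%:E).
  by apply/measurable_EFinP; exact: measurable_pint.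
have nn x : (0 <= (modulus (f x) `^ p * w x)%:E)%E.
  by rewrite lee_fin mulr_ge0 ?powR_ge0// ltW.
have : (\int[mu]_x `|(modulus (f x) `^ p * w x)%:E| = 0)%E.
  under eq_integral do rewrite gee0_abs//.
  by apply/le_anti; rewrite I0 /=; apply: integral_ge0 => x _.
move/(ae_eq_integral_abs mu measurableT m) => H.
apply: (ae_imply H) => x /(_ I) /= [] /eqP.
by rewrite mulf_eq0 (gt_eqF (w0 x)) orbF => /eqP/powR_eq0_eq0.
Qed.

(* The functions supported where [a >= - k] for some [k] lie in unweighted [L^p],
   hence are killed by [S], and they are dense in [L^p(expR \o a)]. *)
Lemma opnorm_eq0 a A : logAp p a A -> opnorm p (fun=> expR 0) S = 0%E ->
  opnorm p (fun x => expR (a x)) S = 0%E.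
Proof.
move=> La S0; have [N [_ N0 _ [dom mS bd]]] := opnorm_logAp La.
have [N1 [N1E N10 _ [dom1 mS1 bd1]]] := opnorm_logAp logAp0.
have {N1E} N1E : N1 = 0 by apply: EFin_inj; rewrite -N1E.
have ma : measurable_fun [set: T] a by case: La.
have mea : measurable_fun [set: T] (fun x => expR (a x)) by exact: measurableT_comp.
apply/le_anti; rewrite opnorm_ge0 andbT.
apply/(opnorm_leP p1 _ (fun x => expR_ge0 (a x)) (lexx 0)) => f Lf.
rewrite powR0 ?gt_eqF// mul0e.
have [mf fy] := (Lp_space_expP p1 a f).1 Lf.
pose th (k : nat) (x : T) : R := ((- k%:R <= a x)%R)%:R.
have mth k : measurable_fun [set: T] (th k).
  rewrite (_ : th k = \1_(a @^-1` `[- k%:R, +oo[%classic)).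
    apply: measurable_indic; rewrite -[X in measurable X]setTI.
    by apply: ma => //; exact: measurable_itv.
  apply/funext => x; rewrite indicE /th; congr (nat_of_bool _)%:R.
  by apply/idP/idP => [h|/set_mem]; [apply/mem_set|]; rewrite /= in_itv/= andbT.
have th01 k x : th k x = 0 \/ th k x = 1 by rewrite /th; case: (_ <= _); [right|left].
pose f0 k : fct := fun x => embed (th k x) * f x.
pose f1 k : fct := fun x => embed (1 - th k x) * f x.
have mf0 k : scalar_measurable (f0 k) by exact: scalar_measurable_embedM.
have mf1 k : scalar_measurable (f1 k).
  by apply: scalar_measurable_embedM => //; apply: measurable_funB.
have me0 : measurable_fun [set: T] (fun=> expR 0 : R) by exact: measurable_cst.
have mod01 (y : R) (z : scalar R s) : y = 0 \/ y = 1 ->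
    modulus (embed y * z) `^ p = y * modulus z `^ p.
  rewrite modulusM modulus_embed => -[] ->.
    by rewrite normr0 !mul0r powR0// gt_eqF.
  by rewrite normr1 !mul1r.
have L0 k : Lp_space p (fun=> expR 0) (f0 k).
  apply/(Lp_space_expP p1 (fun=> 0)); split; first exact: mf0.
  apply: (@le_lt_trans _ _ (pint p (fun x => (expR k%:R * expR (a x))%R) f)).
    apply: pint_le; [by move=> x; exact: expR_ge0|exact: me0|
      by apply: measurable_funM|exact: mf0|exact: mf|].
    move=> x; rewrite /f0 mod01// -expRD /th.
    have m0 := powR_ge0 (modulus (f x)) p.
    have [h|h] := leP (- k%:R) (a x).
      by rewrite mul1r ler_wpM2l// ler_expR; lra.
    by rewrite !mul0r mulr_ge0 ?expR_ge0.
  rewrite -(pintZ p (expR_ge0 k%:R) (fun x => expR_ge0 (a x)) mea mf).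
  by apply: lte_mul_pinfty; rewrite ?lee_fin ?expR_ge0.
have f1le k x : modulus (f1 k x) `^ p * expR (a x) <= modulus (f x) `^ p * expR (a x).
  rewrite ler_wpM2r ?expR_ge0// /f1 mod01.
    by case: (th01 k x) => ->; rewrite ?subrr ?subr0 ?mul0r ?mul1r ?powR_ge0.
  by case: (th01 k x) => ->; rewrite ?subrr ?subr0; [right|left].
have L1 k : Lp_space p (fun x => expR (a x)) (f1 k).
  apply/(Lp_space_expP p1 a); split; first exact: mf1.
  apply: le_lt_trans fy; apply: pint_le; [by move=> x; exact: expR_ge0|
    exact: mea|exact: mea|exact: mf1|exact: mf|exact: f1le].
have Sf0 k : {ae mu, forall x, modulus (S (f0 k) x) = 0}.
  have := bd1 _ (L0 k); rewrite N1E powR0 ?gt_eqF// mul0e.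
  exact: (pint_le0 (fun x => expR_gt0 _) me0 (mS1 _ (L0 k))).
(* Since [S (f0 k)] vanishes almost everywhere, only the tail [f1 k] is left, and dominated
   convergence sends its norm to 0. *)
have le k : (pint p (fun x => expR (a x)) (S f) <=
    (N `^ p)%:E * pint p (fun x => expR (a x)) (f1 k))%E.
  apply: le_trans (bd _ (L1 k)).
  apply: (ae_pint_le (fun x => expR_ge0 (a x)) mea (mS _ Lf) (mS _ (L1 k))).
  have := sublinear_split (th := th k) subS (dom1 _ (L0 k)) (dom _ (L1 k)).
  move=> /(aeI (Sf0 k)) H; apply: (ae_imply H) => x [h0].
  by rewrite -/(f0 k) h0 add0r.
have cv : pint p (fun x => expR (a x)) (f1 k) @[k --> \oo] --> 0%E.
  have [] := @dominated_convergence _ _ R mu setT measurableT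
    (fun k x => (modulus (f1 k x) `^ p * expR (a x))%:E) (cst 0%E)
    (fun x => (modulus (f x) `^ p * expR (a x))%:E).
  - by move=> k; apply/measurable_EFinP; exact: measurable_pint.
  - exact: measurable_cst.
  - apply: aeW => x _; apply: cvg_near_cst.
    exists (Num.bound `|a x|) => // k /= hk.
    have ak := archi_boundP (normr_ge0 (a x)).
    have hk' : (Num.bound `|a x|)%:R <= k%:R :> R by rewrite ler_nat.
    have t1 : th k x = 1.
      have := ler_norm (- a x); rewrite normrN => ha.
      by rewrite /th (_ : (_ <= _) = true)//; apply/idP; lra.
    by rewrite /f1 mod01 t1 subrr; [rewrite !mul0r|left].
  - apply/integrableP; split; first by apply/measurable_EFinP; exact: measurable_pint.
    under eq_integral do rewrite gee0_abs ?lee_fin ?mulr_ge0 ?powR_ge0 ?expR_ge0//.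
    exact: fy.
  - apply: aeW => x k _ /=; rewrite ger0_norm; first by rewrite lee_fin; exact: f1le.
    by rewrite mulr_ge0 ?powR_ge0 ?expR_ge0.
  - by move=> _ _; rewrite integral0.
have Nfin : (N `^ p)%:E \is a fin_num by [].
have := cvge_ge (nearW _ le) (cvgeZl Nfin cv).
by rewrite mule0 => H; exact: H.
Qed.

Lemma opnorm_interpolation a a1 a2 B (N M t : R) : 0 < N -> 0 < M -> 0 < t -> t < 1 ->
  measurable_fun [set: T] a -> measurable_fun [set: T] a1 -> logAp p a2 B ->
  (forall x, a2 x = (1 - t) * a x + t * a1 x) ->
  bounded_on p S (fun x => expR (a x)) N -> bounded_on p S (fun x => expR (a1 x)) M ->
  (opnorm p (fun x => expR (a2 x)) S <= (expR ((1 - t) * ln N + t * ln M))%:E)%E.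
Proof.
move=> N0 M0 t0 t1 ma ma1 La2 E bN bM.
have [_ [_ _ _ [_ mS _]]] := opnorm_logAp La2.
apply/(opnorm_leP p1 _ (fun x => expR_ge0 (a2 x)) (expR_ge0 _)) => f Lf.
have Ea2 : (fun x => expR (a2 x)) = (fun x => expR ((1 - t) * a x + t * a1 x)).
  by apply/funext => x; rewrite E.
have mSf := mS _ Lf; rewrite Ea2 in Lf *.
have bN' : bounded_on p S (fun x => expR (a x)) (expR (ln N)) by rewrite lnK ?posrE.
have bM' : bounded_on p S (fun x => expR (a1 x)) (expR (ln M)) by rewrite lnK ?posrE.
exact: (stein_weiss p1 ma ma1 t0 t1 subS bN' bM' mSf Lf).
Qed.

Lemma opnorm_lower_bound (A N0 : R) : 1 <= A -> 0 < N0 ->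
  opnorm p (fun=> expR 0) S = N0%:E ->
  exists n0 : R, 0 < n0 /\ forall a, logAp p a A ->
    (n0%:E <= opnorm p (fun x => expR (a x)) S)%E.
Proof.
move=> A1 N00 N0E.
(* The largest [r] allowed by [logAp_opp_pow], as [b^-1 = p - 1]. With [t := (1 + r)^-1] below,
   [(1 - t) * a + t * (- (r * a)) = 0], which is the unweighted space. *)
pose r := Num.min b (p - 1).
have r0 : 0 < r by rewrite lt_min b0 p10.
have rb : r <= b by rewrite ge_min lexx.
have rb1 : r * b <= 1 by rewrite ler_pdivrMr// mul1r ge_min lexx orbT.
pose t := (1 + r)^-1.
have t0 : 0 < t by rewrite invr_gt0 addr_gt0.
have t1 : t < 1 by rewrite invf_lt1 ?addr_gt0// ltrDl.
have t1' : 0 < 1 - t by rewrite subr_gt0.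
pose M := Num.max 1 (c * F (A `^ r)).
have M0 : 0 < M by rewrite lt_max ltr01.
(* Solves [N0 = expR ((1 - t) * l + t * ln M)] for [l]. *)
pose l := (ln N0 - t * ln M) / (1 - t).
exists (expR l); split; first exact: expR_gt0.
move=> a La; have ma : measurable_fun [set: T] a by case: La.
have [N [-> N_0 _ bN]] := opnorm_logAp La.
have La' := logAp_opp_pow p1 La (ltW r0) rb rb1.
have ma' : measurable_fun [set: T] (fun x => - (r * a x)) by case: La'.
have [M' [_ M'0 M'le bM']] := opnorm_logAp La'.
have bM : bounded_on p S (fun x => expR (- (r * a x))) M.
  apply: (bounded_on_le (fun x => expR_ge0 _) M'0 _ bM').
  by rewrite le_max M'le orbT.
(* [N] itself might be 0, so its logarithm is avoided: the bound is shown for every positive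
   majorant, then applied to the maximum of [N] and [expR l / 2]. *)
have key N' : 0 < N' -> N <= N' -> expR l <= N'.
  move=> N'0 NN'.
  have bN' : bounded_on p S (fun x => expR (a x)) N'.
    exact: (bounded_on_le (fun x => expR_ge0 _) N_0 NN' bN).
  have := opnorm_interpolation (a2 := fun=> 0) N'0 M0 t0 t1 ma ma' logAp0 _ bN' bM.
  rewrite N0E lee_fin => H.
  have {}H : N0 <= expR ((1 - t) * ln N' + t * ln M).
    apply: H => x; rewrite /t; field; rewrite gt_eqF// addr_gt0//.
  rewrite -[leRHS]lnK ?posrE// ler_expR /l ler_pdivrMr// [leRHS]mulrC lerBlDr.
  by rewrite -ler_expR lnK ?posrE.
rewrite lee_fin leNgt; apply/negP => Nl.
have := key (Num.max N (expR l / 2)); rewrite lt_max divr_gt0 ?expR_gt0// orbT le_max lexx.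
move=> /(_ isT isT); rewrite le_max leNgt Nl /= leNgt.
by rewrite ltr_pdivrMr// ltr_pMr ?expR_gt0// ltr1n.
Qed.

(** [C] is chosen before both weights and depends on [A] but not on the constant [B] of the
    perturbed one. *)
Lemma opnorm_upper_bound (A : R) : 1 <= A -> exists C : R, 0 < C /\
  forall a a' B (d : R), logAp p a A -> logAp p a' B ->
    0 < d -> d < stab_radius (n := n) p A -> locint (fun x => a' x - a x) ->
    (forall P, cint (fun x => `|(a' x - a x) - cavg (fun x => a' x - a x) P|) P <=
      d * vol P) ->
    (opnorm p (fun x => expR (a' x)) S <=
     opnorm p (fun x => expR (a x)) S * (1 + C * d)%:E)%E.
Proof.
move=> A1; have [N0 [N0E N00 _ _]] := opnorm_logAp logAp0.
have [N00'|N0pos] := leP N0 0.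
  exists 1; split=> // a a' B d La La' d0 _ _ _.
  have S0 : opnorm p (fun=> expR 0) S = 0%E.
    by rewrite N0E; congr EFin; apply/le_anti; rewrite N00 N00'.
  by rewrite (opnorm_eq0 La S0) (opnorm_eq0 La' S0) mul0e.
have [n0 [n00 Hn0]] := opnorm_lower_bound A1 N0pos N0E.
set e0 := stab_radius p A; have e00 : 0 < e0 by exact: stab_radius_gt0.
pose K := stab_const p A; pose M := Num.max 1 (c * F K).
have M0 : 0 < M by rewrite lt_max ltr01.
(* Bounds [ln (M / N)] from above for all admissible weights, so the interpolation factor
   [(M / N)^t] is at most [expR (t * lam) <= 1 + t * lam * expR lam]. With [t = d / e0] this gives
   [C], where the extra 1 ensures positivity. *)
pose lam := Num.max 0 (ln M - ln n0).
have lam0 : 0 <= lam by rewrite le_max lexx.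
exists (lam * expR lam / e0 + 1); split.
  by rewrite ltr_wpDl// divr_ge0 ?(ltW e00)// mulr_ge0// expR_ge0.
move=> a a' B d La La' d0 de0 Ig Hg.
pose t := d / e0.
have t0 : 0 < t by rewrite divr_gt0.
have t1 : t < 1 by rewrite ltr_pdivrMr// mul1r.
(* Stretching by [t^-1 = e0 / d] raises the oscillation bound from [d] to exactly the stability
   radius [e0]. *)
pose g x := t^-1 * (a' x - a x).
have Igt : locint g by exact: locintZ.
have Hgt P : cint (fun x => `|g x - cavg g P|) P <= e0 * vol P.
  have te : `|t^-1| * d = e0.
    by rewrite ger0_norm ?invr_ge0 ?(ltW t0)// /t invf_div divfK// gt_eqF.
  rewrite -te; exact: (oscZ t^-1 Ig Hg P).
have Lg := logAp_stable p1 A1 La Igt Hgt.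
have [N [NE N_0 _ bN]] := opnorm_logAp La.
have [M' [_ M'0 M'le bM']] := opnorm_logAp Lg.
have bM : bounded_on p S (fun x => expR (a x + g x)) M.
  apply: (bounded_on_le (fun x => expR_ge0 _) M'0 _ bM').
  by rewrite le_max M'le orbT.
have ma : measurable_fun [set: T] a by case: La.
have mg : measurable_fun [set: T] (fun x => a x + g x) by case: Lg.
have n0N : n0 <= N by rewrite -lee_fin -NE; exact: Hn0.
have Npos : 0 < N by exact: lt_le_trans n0N.
have E x : a' x = (1 - t) * a x + t * (a x + g x).
  by rewrite /g; field; rewrite gt_eqF.
apply: le_trans (opnorm_interpolation Npos M0 t0 t1 ma mg La' E bN bM) _.
rewrite NE -EFinM lee_fin.
rewrite [(1 - t) * ln N + _](_ : _ = ln N + t * (ln M - ln N)); last by ring.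
rewrite expRD lnK ?posrE// ler_wpM2l//.
have h1 : t * (ln M - ln N) <= t * lam.
  rewrite ler_wpM2l ?(ltW t0)// le_max; apply/orP; right.
  by rewrite lerB// ler_ln ?posrE.
apply: (@le_trans _ _ (expR (t * lam))); first by rewrite ler_expR.
have h2 : expR (t * lam) <= 1 + t * lam * expR (t * lam).
  have := expR_ge1Dx (- (t * lam)); have := expRxMexpNx_1 (t * lam).
  have := expR_gt0 (t * lam); nra.
apply: (le_trans h2); rewrite lerD2l mulrDl mul1r.
have h3 : t * lam * expR (t * lam) <= t * lam * expR lam.
  apply: ler_wpM2l; first by rewrite mulr_ge0// ltW.
  by rewrite ler_expR ler_piMl// ltW.
apply: (le_trans h3); rewrite -[leLHS]addr0 lerD ?(ltW d0)//.
by rewrite /t le_eqVlt; apply/orP; left; apply/eqP; field; rewrite gt_eqF.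
Qed.

End Continuity.

(** * Replacing a weight by the exponential of its logarithm, off a null set *)

Section LogOfWeight.
Context {R : realType} {n : nat}.
Local Notation mu := (@lebesgue_measure_tuple R n).
Local Notation T := (n.-tuple R).
Implicit Types (w : T -> R).

Lemma eq_integral_cubes (f g : T -> R) Q : cubes Q -> measurable_fun [set: T] f ->
  measurable_fun [set: T] g -> {ae mu, forall x, f x = g x} ->
  (\int[mu]_(x in Q) (f x)%:E = \int[mu]_(x in Q) (g x)%:E)%E.
Proof.
move=> /cubesP[P ->] mf mg fg.
have [mC _] := @lebesgue_measure_cube R n P.1 P.2%:num (ltW [gt0 of P.2%:num]).
apply: ae_eq_integral => //.
- by apply/measurable_EFinP; exact: measurable_funS mf.
- by apply/measurable_EFinP; exact: measurable_funS mg.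
- by apply: (ae_imply fg) => x -> _.
Qed.

Lemma eq_average (f g : T -> R) Q : cubes Q -> measurable_fun [set: T] f ->
  measurable_fun [set: T] g -> {ae mu, forall x, f x = g x} ->
  average Q (fun x => (f x)%:E) = average Q (fun x => (g x)%:E).
Proof. by move=> cQ mf mg fg; rewrite /average (eq_integral_cubes cQ mf mg fg). Qed.

Lemma eq_Ap (p : R) w w' : measurable_fun [set: T] w' ->
  {ae mu, forall x, w x = w' x} -> Ap p w ->
  Ap p w' /\ Ap_const p w' = Ap_const p w.
Proof.
move=> mw' ae [[mw wy w0] Ay].
have E1 Q (cQ : cubes Q) := eq_average cQ mw mw' ae.
have mp (v : T -> R) q : measurable_fun [set: T] v ->
    measurable_fun [set: T] (fun x => v x `^ q).
  exact: (measurableT_comp (measurable_powR q)).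
have ae' q : {ae mu, forall x, w x `^ q = w' x `^ q}.
  by apply: (ae_imply ae) => x ->.
have E2 Q : cubes Q -> (average Q (fun x => (w x `^ (1 - conj_exponent p))%:E) =
    average Q (fun x => (w' x `^ (1 - conj_exponent p))%:E))%E.
  by move=> cQ; exact: (eq_average cQ (mp _ _ mw) (mp _ _ mw') (ae' _)).
have AE : Ap_const p w' = Ap_const p w.
  rewrite /Ap_const; apply: (f_equal (@ereal_sup R)).
  apply/seteqP; split=> _ [Q cQ <-]; (exists Q; first exact: cQ);
    by rewrite (E1 Q cQ) (E2 Q cQ).
split; last exact: AE.
split; last by rewrite AE.
split; [exact: mw'| |by apply: (ae_imply (aeI ae w0)) => x [<-]].
move=> Q cQ; have := wy Q cQ.
have mabs (v : T -> R) : measurable_fun [set: T] v ->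
    measurable_fun [set: T] (fun x => `|v x|) by move=> mv; exact: measurableT_comp.
have abs_ae : {ae mu, forall x, `|w x| = `|w' x|} by apply: (ae_imply ae) => x ->.
rewrite (eq_integral_cubes cQ (mabs _ mw) (mabs _ mw') abs_ae); exact.
Qed.

Lemma Ap_ln (p : R) w : Ap p w ->
  [/\ measurable_fun [set: T] (fun x => ln (w x)),
      {ae mu, forall x, w x = expR (ln (w x))},
      Ap p (fun x => expR (ln (w x))) &
      Ap_const p (fun x => expR (ln (w x))) = Ap_const p w].
Proof.
move=> Aw; have [[mw wy w0] Ay] := Aw.
have ma : measurable_fun [set: T] (fun x => ln (w x)).
  by apply: measurableT_comp; [exact: measurable_ln|exact: mw].
have mea : measurable_fun [set: T] (fun x => expR (ln (w x))) by exact: measurableT_comp.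
have ae : {ae mu, forall x, w x = expR (ln (w x))}.
  by apply: (ae_imply w0) => x x0; rewrite lnK ?posrE.
have [Aew AE] := eq_Ap mea ae Aw; split; [exact: ma|exact: ae|exact: Aew|exact: AE].
Qed.

(** Homogeneity is read from [k * f = (k - 1) * f + f], which avoids evaluating the operator at
    0. *)
Lemma linear_sublinear (s : scalars) (S : operator R s n) :
  linear_operator S -> sublinear_operator S.
Proof.
move=> lS.
have addE (f g : T -> scalar R s) : (fun x => 1 * f x + g x) = (fun x => f x + g x).
  by apply/funext => x; rewrite mul1r.
have mulE (k : scalar R s) (f : T -> scalar R s) :
    (fun x => (k - 1) * f x + f x) = (fun x => k * f x).
  by apply/funext => x; rewrite mulrBl mul1r subrK.
split=> [f g df dg|f g df dg|k f df].
- by have [] := lS 1 f g df dg; rewrite addE.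
- have [_] := lS 1 f g df dg; rewrite addE => H.
  by apply: (ae_imply H) => x ->; rewrite mul1r modulusD.
- have [] := lS (k - 1) f f df df; rewrite mulE => dk H; split=> //.
  apply: (ae_imply H) => x ->.
  by rewrite mulrBl mul1r subrK modulusM.
Qed.

End LogOfWeight.

(** * The two conclusions for general A_p weights *)

Section Final.
Context {R : realType} {s : scalars} {n : nat}.
Local Notation T := (n.-tuple R).
Variables (p : R) (F : R -> R) (c : R).
Hypothesis p1 : 1 < p.
Hypothesis Fmono : forall x y : R, 1 <= x -> x <= y -> F x <= F y.
Hypothesis c0 : 0 < c.
Variable S : operator R s n.
Hypothesis wb : weighted_bound p F c S.
Hypothesis subS : sublinear_operator S.

Lemma opnorm_ln (w : T -> R) : Ap p w ->
  opnorm p w S = opnorm p (fun x => expR (ln (w x))) S.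
Proof.
move=> Aw; have [ma ae _ _] := Ap_ln Aw; have [_ mS _] := wb Aw.
apply: eq_opnorm => //; first by case: Aw => -[].
exact: measurableT_comp.
Qed.

Lemma logAp_ln (w : T -> R) : Ap p w ->
  Ap_const p w = (fine (Ap_const p w))%:E /\
  logAp p (fun x => ln (w x)) (fine (Ap_const p w)).
Proof.
move=> Aw; have [ma _ Aew AE] := Ap_ln Aw.
by have := Ap_logAp p1 ma Aew; rewrite AE.
Qed.

Lemma dstar_le (w w0 : T -> R) (d : R) : Ap p w -> Ap p w0 ->
  (dstar w w0 <= d%:E)%E ->
  locint (fun x => ln (w x) - ln (w0 x)) /\
  forall P, cint (fun x => `|(ln (w x) - ln (w0 x)) -
    cavg (fun x => ln (w x) - ln (w0 x)) P|) P <= d * vol P.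
Proof.
move=> Aw Aw0; have [ma _ _ _] := Ap_ln Aw; have [ma0 _ _ _] := Ap_ln Aw0.
by apply: BMO_norm_le; apply: measurable_funB.
Qed.

Lemma opnorm_sublinear_le (A : R) : exists C : R, 0 < C /\
  forall w0 : T -> R, Ap p w0 -> Ap_const p w0 = A%:E ->
    exists delta0 : R, 0 < delta0 /\
      forall delta : R, 0 < delta -> delta < delta0 ->
      forall w : T -> R, Ap p w -> (dstar w w0 <= delta%:E)%E ->
        (opnorm p w S <= opnorm p w0 S * (1 + C * delta)%:E)%E.
Proof.
(* [C] must be fixed before any weight is given, so [A >= 1] cannot be deduced yet; the maximum
   replaces it. *)
have A'1 : 1 <= Num.max 1 A by rewrite le_max lexx.
have [C [C0 H]] := opnorm_upper_bound p1 Fmono c0 wb subS A'1.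
exists C; split=> // w0 Aw0 AE.
exists (stab_radius (n := n) p (Num.max 1 A)); split; first exact: stab_radius_gt0.
move=> d d0 dd w Aw dw; rewrite (opnorm_ln Aw) (opnorm_ln Aw0).
have [_ La0] := logAp_ln Aw0; have [_ La] := logAp_ln Aw.
have [Ig Hg] := dstar_le Aw Aw0 dw.
rewrite AE /= in La0.
have La0' : logAp p (fun x => ln (w0 x)) (Num.max 1 A).
  by apply: logAp_le La0; rewrite le_max lexx orbT.
exact: (H _ _ _ _ La0' La d0 dd Ig Hg).
Qed.

Lemma opnorm_continuous (w0 : T -> R) (eta : R) : Ap p w0 -> 0 < eta ->
  exists rho : R, 0 < rho /\
    forall w : T -> R, Ap p w -> (dstar w w0 < rho%:E)%E ->
      (`|opnorm p w S - opnorm p w0 S| < eta%:E)%E.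
Proof.
move=> Aw0 eta0; have [_ La0] := logAp_ln Aw0.
set A := fine _ in La0; have A1 := logAp_ge1 p1 La0.
pose K := Num.max 1 (stab_const p A).
have K1 : 1 <= K by rewrite le_max lexx.
have [C1 [C10 H1]] := opnorm_upper_bound p1 Fmono c0 wb subS A1.
have [C2 [C20 H2]] := opnorm_upper_bound p1 Fmono c0 wb subS K1.
have [N [NE N0 _ _]] := opnorm_logAp p1 Fmono c0 wb La0.
(* For [rho <= 1]: [N' - N <= N * C1 * rho], so [N' <= N * (1 + C1)], and then
   [N - N' <= N * (1 + C1) * C2 * rho]. The added 1 keeps [D] positive when [N = 0]. *)
pose D := N * (C1 + (1 + C1) * C2) + 1.
have D0 : 0 < D by rewrite ltr_wpDl// mulr_ge0// addr_ge0 ?mulr_ge0 ?addr_ge0 ?ltW.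
pose m := Num.min (Num.min (stab_radius (n := n) p A) (stab_radius (n := n) p K))
  (Num.min 1 (eta / D)).
have m0 : 0 < m by rewrite !lt_min !stab_radius_gt0// divr_gt0// ltr01.
have [m1 [m2 [m3 m4]]] : m <= stab_radius (n := n) p A /\
    (m <= stab_radius (n := n) p K /\ (m <= 1 /\ m <= eta / D)).
  by split; [|split; [|split]]; rewrite !ge_min lexx ?orbT.
(* Halving gives the strict inequalities that [opnorm_upper_bound] requires. *)
pose rho := m / 2; have rho0 : 0 < rho by rewrite divr_gt0.
have rhom : rho < m by rewrite ltr_pdivrMr// ltr_pMr// ltr1n.
exists rho; split=> // w Aw /ltW dw; rewrite (opnorm_ln Aw) (opnorm_ln Aw0) NE.
have [_ La] := logAp_ln Aw.
have [Ig Hg] := dstar_le Aw Aw0 dw.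
have lew e P : rho <= e -> cint (fun x => `|(ln (w x) - ln (w0 x)) -
    cavg (fun x => ln (w x) - ln (w0 x)) P|) P <= e * vol P.
  by move=> re; apply: le_trans (Hg P) _; rewrite ler_wpM2r// ltW// vol_gt0.
have LaK : logAp p (fun x => ln (w x)) K.
  have := logAp_stable p1 A1 La0 Ig
    (fun P => lew _ P (le_trans (ltW rhom) m1)).
  rewrite (_ : (fun x => _) = (fun x => ln (w x))); last first.
    by apply/funext => x; rewrite subrKC.
  by apply: logAp_le; rewrite le_max lexx orbT.
have [N' [N'E N'0 _ _]] := opnorm_logAp p1 Fmono c0 wb LaK.
have := H1 _ _ _ _ La0 LaK rho0 (lt_le_trans rhom m1) Ig Hg.
have E : (fun x => ln (w0 x) - ln (w x)) = (fun x => - 1 * (ln (w x) - ln (w0 x))).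
  by apply/funext => x; rewrite mulN1r opprB.
have Ig' : locint (fun x => ln (w0 x) - ln (w x)) by rewrite E; exact: locintZ.
have Hg' P : cint (fun x => `|(ln (w0 x) - ln (w x)) -
    cavg (fun x => ln (w0 x) - ln (w x)) P|) P <= rho * vol P.
  have := oscZ (-1) Ig Hg P; rewrite normrN1 mul1r; apply: le_trans.
  by rewrite E le_eqVlt; apply/orP; left; apply/eqP; congr cint;
    apply/funext => x; rewrite mulN1r opprB.
have := H2 _ _ _ _ LaK La0 rho0 (lt_le_trans rhom m2) Ig' Hg'.
rewrite NE N'E -!EFinM !lee_fin => h2 h1.
rewrite -EFinB abse_EFin lte_fin.
have rhoD : rho * D < eta.
  by rewrite -ltr_pdivlMr//; exact: lt_le_trans rhom m4.
have rho1 : rho <= 1 by rewrite (le_trans (ltW rhom)).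
have h3 : N' <= N * (1 + C1).
  by apply: (le_trans h1); rewrite ler_wpM2l// lerD2l ler_piMr// ltW.
have h4 : N' * (C2 * rho) <= N * (1 + C1) * (C2 * rho).
  by rewrite ler_wpM2r// mulr_ge0// ltW.
have rhoDE : rho * D = N * C1 * rho + N * (1 + C1) * (C2 * rho) + rho.
  by rewrite /D; ring.
have p1' : 0 <= N * C1 * rho by rewrite !mulr_ge0// ltW.
have p2' : 0 <= N * (1 + C1) * (C2 * rho).
  by rewrite !mulr_ge0// ?addr_ge0// ltW.
rewrite ltr_norml; apply/andP; split; lra.
Qed.

End Final.

Theorem theorem5 (R : realType) (s : scalars) (n : nat) (p : R)
    (F : R -> R) (c : R)
    (hn : (0 < n)%N) (hp : 1 < p)
    (hF : forall x y : R, 1 <= x -> x <= y -> F x <= F y)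
    (hc : 0 < c) :
  (forall (w0 : n.-tuple R -> R) (T : operator R s n), Ap p w0 ->
    linear_operator T -> weighted_bound p F c T ->
    forall eta : R, 0 < eta -> exists rho : R, 0 < rho /\
      forall w : n.-tuple R -> R, Ap p w -> (dstar w w0 < rho%:E)%E ->
        (`|opnorm p w T - opnorm p w0 T| < eta%:E)%E)
  /\
  (forall T : operator R s n,
    sublinear_operator T -> weighted_bound p F c T ->
    forall A : R, exists C : R, 0 < C /\
      forall w0 : n.-tuple R -> R, Ap p w0 -> Ap_const p w0 = A%:E ->
        exists delta0 : R, 0 < delta0 /\
          forall delta : R, 0 < delta -> delta < delta0 ->
          forall w : n.-tuple R -> R, Ap p w -> (dstar w w0 <= delta%:E)%E ->
            (opnorm p w T <= opnorm p w0 T * (1 + C * delta)%:E)%E).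
Proof.
split=> [w0 T Aw0 linT wbT eta eta0|T subT wbT A].
  exact: (opnorm_continuous hp hF hc wbT (linear_sublinear linT) Aw0 eta0).
exact: (opnorm_sublinear_le hp hF hc wbT subT A).
Qed.
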